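(* Let $V$ be a real locally convex topological vector space, $H$ a real Hilbert space and $j:V\to H$ a linear, weak-to-weak continuous operator. Assume that $\varphi:V\to\mathbb{R}\cup\{+\infty\}$ is convex, proper, lower semicontinuous and $j$-elliptic, and let $S$ be the semigroup on $H$ generated by $(\varphi,j)$. Let $C\subseteq H$ be a (non-empty) closed, convex set, and denote by $P_C$ the orthogonal projection of $H$ onto $C$. Then the following assertions are equivalent: (1) The semigroup $S$ leaves $C$ invariant. (2) For every $\lambda>0$ the resolvent $J_\lambda$ of $\partial_j\varphi$ leaves $C$ invariant. (3) For every $u\in H$ one has $\varphi^H(P_Cu)\le\varphi^H(u)$. (4) For every $\hat u\in D(\varphi)$ there is a $\hat v\in D(\varphi)$ such that $P_Cj(\hat u)=j(\hat v)$ and $\varphi(\hat v)\le\varphi(\hat u)$.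
   Context: The effective domain of $\varphi$ is $D(\varphi)=\{\varphi<+\infty\}$; $\varphi$ is proper if $D(\varphi)\neq\emptyset$, lower semicontinuous if all sublevels $\{\varphi\le c\}$, $c\in\mathbb{R}$, are closed, and coercive if all sublevels are relatively weakly compact. The functional $\varphi$ is $j$-elliptic if there exists $\omega\ge 0$ such that $\hat u\mapsto\varphi(\hat u)+\frac{\omega}{2}\|j(\hat u)\|_H^2$ is convex and coercive. The $j$-subgradient of $\varphi$ is $$\partial_j\varphi=\Big\{(u,f)\in H\times H \;:\; \exists\,\hat u\in D(\varphi)\text{ with } j(\hat u)=u \text{ and, for every }\hat v\in V,\ \liminf_{t\searrow 0}\frac{\varphi(\hat u+t\hat v)-\varphi(\hat u)}{t}\ge\langle f,j(\hat v)\rangle_H\Big\}.$$ $\partial\psi$ denotes the classical subgradient of a functional $\psi$ on $H$ (the case $V=H$, $j=I$). $\varphi^H:H\to\mathbb{R}\cup\{+\infty\}$ denotes a convex, proper, lower semicontinuous functional with $\partial_j\varphi\subseteq\partial\varphi^H$; it exists, is unique up to an additive constant, and modulo that constant $\varphi^H(u)=\inf\{\varphi(\hat u): j(\hat u)=u\}$. The resolvent is $J_\lambda=(I+\lambda\,\partial_j\varphi)^{-1}$, a map on $H$. The semigroup generated by $(\varphi,j)$: for every $u_0\in\overline{D(\varphi^H)}=\overline{j(D(\varphi))}$ the problem $\dot u+\partial_j\varphi(u)\ni 0$ a.e. on $(0,\infty)$, $u(0)=u_0$, has a unique solution $u\in C(\mathbb{R}_+;H)\cap W^{1,\infty}_{loc}((0,\infty);H)$,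 and $S(t)u_0:=u(t)$. It is extended to all of $H$ by replacing $S(t)$ with $S(t)P$, where $P$ is the orthogonal projection of $H$ onto $\overline{D(\varphi^H)}$. A map $T$ leaves $C$ invariant if $TC\subseteq C$; the semigroup $S$ leaves $C$ invariant if $S(t)$ does for every $t\ge 0$. *)

(* Defs.v *)
From HB Require Import structures.
From mathcomp Require Import all_boot all_order all_algebra.
From mathcomp Require Import sesquilinear.
From mathcomp Require Import all_classical all_reals all_analysis.
Import Order.TTheory GRing.Theory Num.Theory.
Import numFieldNormedType.Exports.

Set Implicit Arguments.
Unset Strict Implicit.
Unset Printing Implicit Defensive.

Local Open Scope classical_set_scope.
Local Open Scope ring_scope.

Section weak_topology.
Context {R : realType}.

Definition topdual (E : tvsType R) := {f : {linear E -> R^o} | continuous f}.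

(* The coarsest topology making every continuous linear functional continuous:
   it is induced by x |-> (f |-> f x) from the topology of pointwise
   convergence on the functions topdual E -> R. *)
Definition weak (E : tvsType R) : topologicalType :=
  initial_topology
    (fun x : E => (fun f : topdual E => sval f x) : {ptws topdual E -> R^o}).

Definition weak_continuous (E F : tvsType R) (f : E -> F) :=
  continuous (f : weak E -> weak F).

End weak_topology.

Section functionals.
Context {R : realType}.
Local Open Scope ereal_scope.

Definition sublevel (E : Type) (psi : E -> \bar R) (c : R) : set E :=
  [set x | psi x <= c%:E].

(* Functionals with values in R \cup {+oo} are functions to \bar R that avoid
   -oo. *)
Definition ninfty_free (E : Type) (psi : E -> \bar R) :=
  forall x, psi x != -oo.

Definition effdom (E : Type) (psi : E -> \bar R) : set E :=
  [set x | psi x < +oo].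

Definition proper_functional (E : Type) (psi : E -> \bar R) := effdom psi !=set0.

(* The library's convex_function only concerns real-valued functions. Here
   0 * +oo = 0, so t = 0 and t = 1 impose no condition. *)
Definition convex_functional (E : lmodType R) (psi : E -> \bar R) :=
  forall (x y : E) (t : R), (0 <= t <= 1)%R ->
    psi (t *: x + (1 - t) *: y)%R <= t%:E * psi x + (1 - t)%:E * psi y.

Definition coercive (E : tvsType R) (psi : E -> \bar R) :=
  forall c : R, precompact (sublevel psi c : set (weak E)).

Lemma lower_semicontinuous_sublevel (E : topologicalType) (psi : E -> \bar R) :
  lower_semicontinuous psi <-> forall c, closed (sublevel psi c).
Proof.
have sublevelC c : ~` [set x | c%:E < psi x] = sublevel psi c.
  by apply/seteqP; split=> x /=; rewrite /sublevel /= leNgt => /negP.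
split=> [/lower_semicontinuousP psio c|psic].
  by rewrite -sublevelC closedC; exact: psio.
apply/lower_semicontinuousP => c; rewrite -closedC sublevelC; exact: psic.
Qed.

End functionals.

Section j_elliptic_functionals.
Context {R : realType} {H : completeNormedModType R}.
Implicit Types (C : set H) (phiH : H -> \bar R).

Definition j_elliptic (V : tvsType R) (phi : V -> \bar R) (j : V -> H) :=
  exists2 omega : R, 0 <= omega &
    let phi_omega v := (phi v + (omega / 2 * `|j v| ^+ 2)%:E)%E in
    convex_functional phi_omega /\ coercive phi_omega.

(* In a Hilbert space the nearest point of a non-empty closed convex set exists
   and is unique; get picks an arbitrary point otherwise. *)
Definition orth_proj C (u : H) : H :=
  get [set p | C p /\ forall q, C q -> `|u - p| <= `|u - q|].

Definition leaves_invariant (T : H -> H) C := T @` C `<=` C.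

Context (dot : {dot H for idfun}).

Definition jsubgradient (V : lmodType R) (phi : V -> \bar R) (j : V -> H) :
    set (H * H) :=
  [set uf | exists uh : V, [/\ effdom phi uh, j uh = uf.1 &
     forall vh : V, ((dot uf.2 (j vh))%:E <=
       limf_einf (fun t : R => (phi (uh + t *: vh)%R - phi uh) * (t^-1)%:E)
         0^'+)%E]].

Definition subgradient (psi : H -> \bar R) : set (H * H) :=
  jsubgradient psi idfun.

(* (I + lambda d_j phi)^-1 as a map. *)
Definition resolvent (V : lmodType R) (phi : V -> \bar R) (j : V -> H)
    (lambda : R) (u : H) : H :=
  get [set v | exists2 f, jsubgradient phi j (v, f) & v + lambda *: f = u].

(* This determines phiH up to an additive constant. *)
Definition is_phiH (V : lmodType R) (phi : V -> \bar R) (j : V -> H) phiH :=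
  [/\ ninfty_free phiH, convex_functional phiH, proper_functional phiH,
      lower_semicontinuous phiH &
      jsubgradient phi j `<=` subgradient phiH].

(* Strong (Bochner) measurability: pointwise limit of simple functions. *)
Definition strongly_measurable (g : R -> H) :=
  exists2 s : (R -> H)^nat,
    (forall n, finite_set (range (s n)) /\
               forall x, measurable (s n @^-1` [set x])) &
    forall t, s ^~ t @ \oo --> g t.

Definition locally_ess_bounded (g : R -> H) :=
  forall a b : R, 0 < a -> exists M : R,
    {ae lebesgue_measure, forall t : R, a <= t <= b -> `|g t| <= M}.

(* C^1 functions with compact support in ]0, +oo[. *)
Definition test_function (eta : R -> R) :=
  [/\ forall t, derivable eta t 1, continuous (derive1 eta) &
      exists a b : R, 0 < a /\ forall t, ~~ (a <= t <= b) -> eta t = 0].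

(* u' = g in the weak sense on ]0, +oo[: the identity of Bochner integrals
   \int u eta' = - \int g eta is tested against every h : H. *)
Definition weak_derivative (u g : R -> H) :=
  forall (eta : R -> R) (h : H), test_function eta ->
    (\int[lebesgue_measure]_(t in `]0%R, +oo[) (dot (u t) h * derive1 eta t)%:E =
     - \int[lebesgue_measure]_(t in `]0%R, +oo[) (dot (g t) h * eta t)%:E)%E.

(* u in C([0, +oo[; H) \cap W^{1,oo}_loc(]0, +oo[; H), with weak derivative g,
   satisfies u' + d_j phi(u) \ni 0 a.e. and u(0) = u0. That u itself is locally
   bounded follows from continuity. *)
Definition gradient_flow (V : lmodType R) (phi : V -> \bar R) (j : V -> H)
    (u0 : H) (u : R -> H) :=
  [/\ {within `[0, +oo[, continuous u}, u 0 = u0 &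
      exists g : R -> H, [/\ strongly_measurable g, locally_ess_bounded g,
        weak_derivative u g &
        {ae lebesgue_measure, forall t : R, 0 < t ->
           jsubgradient phi j (u t, - g t)}]].

(* The values of S at negative times are irrelevant. *)
Definition generated_semigroup (V : lmodType R) (phi : V -> \bar R)
    (j : V -> H) (S : R -> H -> H) :=
  let K := closure (j @` effdom phi) in
  (forall u0, K u0 -> gradient_flow phi j u0 (S ^~ u0)) /\
  (forall t u0, 0 <= t -> S t u0 = S t (orth_proj K u0)).

Definition semigroup_leaves_invariant (S : R -> H -> H) C :=
  forall t : R, 0 <= t -> leaves_invariant (S t) C.

End j_elliptic_functionals.

(* Main.v *)
Require Import Defs.
From HB Require Import structures.
From mathcomp Require Import all_boot all_order all_algebra.
From mathcomp Require Import sesquilinear.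
From mathcomp Require Import all_classical all_reals all_analysis.
From mathcomp Require Import measurable_realfun ring lra.
Import Order.TTheory GRing.Theory Num.Theory.
Import numFieldNormedType.Exports.

Set Implicit Arguments.
Unset Strict Implicit.
Unset Printing Implicit Defensive.

Local Open Scope classical_set_scope.
Local Open Scope ring_scope.

(** Write P for the projection onto C and J lambda for the resolvents. The
    assertions are proved equivalent along the cycle semigroup, phiH, resolvents,
    lifting, semigroup.

    From the semigroup to phiH (semigroup_invariant_phiH_proj_le): were phiH (P u)
    larger than phiH u, then by lower semicontinuity and the subgradient
    inequality the trajectory starting at P u would approach u at a positive
    rate; but it stays in C, where P u is the point nearest to u.

    From phiH to the resolvents (phiH_proj_le_resolvent_invariant): for u in C
    and v = J lambda u, the variational inequalities for v and for P v sum up to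
    the squared norm of P v - v being nonpositive.

    From the resolvents to the lifting (resolvent_invariant_lift): preimages
    under j of the points J lambda (P (j uh)) lie in sublevels of phi with a
    penalty of weight 1 / lambda on the distance to P (j uh). These sublevels are
    weakly compact and decrease with lambda, and a common point is the required
    vh.

    From the lifting to the semigroup (lift_semigroup_invariant): along a
    trajectory u with derivative g, half the squared distance to C has derivative
    dot (g r) (u r - P (u r)), which the lifting bounds by
    phi vh - phi uh <= 0.

    Two bodies of theory carry these arguments. The first is the existence of the
    resolvents for every lambda > 0 (resolventP), obtained by minimizing phi plus
    a quadratic penalty over V. It relies on weak compactness of the sublevels,
    hence on Mazur's theorem (closed_convex_weakly_closed) and on the
    Hahn-Banach theorem; the latter is proved by showing that minimal sublinear
    functionals are linear. The second is a differential inequality for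
    functions that have only a weak derivative (weak_derivative_decay): testing
    with spline plateaus bounds dot (u t - u s) h by an almost everywhere bound
    of dot g h (weak_derivative_le), and a function of u whose first order
    expansion has a quadratic error is then controlled by subdividing the time
    interval. *)

(** * Separation in locally convex spaces *)

Section sublinear_functionals.
Context {R : realType} {E : lmodType R}.
Implicit Types (p q : E -> R) (x y : E).

Definition sublinear p :=
  (forall x y, p (x + y) <= p x + p y) /\
  (forall t x, 0 < t -> p (t *: x) <= t * p x).

Lemma sublinearZ p t x : sublinear p -> 0 < t -> p (t *: x) = t * p x.
Proof.
move=> [_ pZ] t0; apply/eqP; rewrite eq_le pZ//=.
have t10 : 0 < t^-1 by rewrite invr_gt0.
rewrite -ler_pdivlMl// -{1}[x]scale1r -(@mulVf _ t) ?gt_eqF// -scalerA.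
exact: pZ.
Qed.

Lemma sublinear0 p : sublinear p -> p 0 = 0.
Proof.
move=> ps; have := sublinearZ 0 ps (ltr0n R 2); rewrite scaler0 => /eqP.
by rewrite -subr_eq0 -{1}[p 0]mul1r -mulrBl mulf_eq0 => /orP[/eqP|/eqP//]; lra.
Qed.

Lemma sublinear_ge p x : sublinear p -> - p (- x) <= p x.
Proof.
move=> ps; have [pD _] := ps; have := pD x (- x).
by rewrite subrr (sublinear0 ps); lra.
Qed.

(** The constructions of sublinear functionals below (gauges, infima of chains,
    infima along rays) all have this form: the lower boundary of a convex cone
    in E * R that lies above the graph of some function. *)
Lemma sublinear_inf (K : E -> set R) (l : E -> R) :
  (forall x, K x !=set0) -> (forall x r, K x r -> l x <= r) ->
  (forall x y r s, K x r -> K y s -> K (x + y) (r + s)) ->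
  (forall t x r, 0 < t -> K x r -> K (t *: x) (t * r)) ->
  sublinear (fun x => inf (K x)).
Proof.
move=> K0 Kl KD KZ.
have Kb x : has_lbound (K x) by exists (l x) => r; exact: Kl.
split=> [x y|t x t0].
  rewrite -lerBlDl; apply: lb_le_inf (K0 y) _ => s Ks.
  rewrite lerBlDr -lerBlDl; apply: lb_le_inf (K0 x) _ => r Kr.
  by rewrite lerBlDr; apply: (ge_inf (Kb _)); exact: KD.
rewrite -ler_pdivrMl//; apply: lb_le_inf (K0 x) _ => r Kr.
by rewrite ler_pdivrMl//; apply: (ge_inf (Kb _)); exact: KZ.
Qed.

Definition ray_cone q y x : set R :=
  [set r | exists2 t, 0 <= t & q (x + t *: y) - t * q y <= r].

Lemma ray_cone_lbound q y x : sublinear q -> lbound (ray_cone q y x) (- q (- x)).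
Proof.
move=> qs r [t t0]; apply: le_trans.
have [qD _] := qs; have := qD (x + t *: y) (- x); rewrite addrAC subrr add0r.
case: (ltgtP t 0) t0 => // [t0 _|-> _]; first by rewrite (sublinearZ _ qs)//; lra.
by rewrite scale0r (sublinear0 qs); lra.
Qed.

(** Lowering q along the ray of y: the result is the largest sublinear
    functional below q whose value at - y is at most - q y. *)
Lemma sublinear_ray q y : sublinear q ->
  let q' x := inf (ray_cone q y x) in
  [/\ sublinear q', forall x, q' x <= q x & q' (- y) <= - q y].
Proof.
move=> qs q'; have [qD qZ] := qs.
have lb x : has_lbound (ray_cone q y x).
  by exists (- q (- x)); exact: ray_cone_lbound.
split.
- apply: (@sublinear_inf _ (fun x => - q (- x))).
  + by move=> x; exists (q x), 0; rewrite // scale0r addr0 mul0r subr0.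
  + by move=> x r; exact: ray_cone_lbound.
  + move=> x1 x2 r1 r2 [t1 t10 h1] [t2 t20 h2]; exists (t1 + t2).
      exact: addr_ge0.
    have := qD (x1 + t1 *: y) (x2 + t2 *: y).
    by rewrite addrACA -scalerDl; lra.
  + move=> t x r t0 [s s0 h]; exists (t * s); first by rewrite mulr_ge0// ltW.
    rewrite -scalerA -scalerDr (sublinearZ _ qs)// -mulrA -mulrBr.
    by rewrite ler_pM2l.
- move=> x; apply: (ge_inf (lb x)); exists 0 => //.
  by rewrite scale0r addr0 mul0r subr0.
- apply: (ge_inf (lb _)); exists 1 => //.
  by rewrite scale1r addNr (sublinear0 qs) mul1r add0r.
Qed.

(** A minimal sublinear functional q is linear: lowering it along the ray of y
    does not change it, which reads q x + q y <= q (x + y). *)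
Lemma minimal_sublinear_linear q : sublinear q ->
  (forall p, sublinear p -> (forall x, p x <= q x) -> p = q) ->
  forall a x y, q (a *: x + y) = a * q x + q y.
Proof.
move=> qs qmin; have [qD qZ] := qs.
have add x y : q (x + y) = q x + q y.
  apply/eqP; rewrite eq_le qD/=.
  have [ps pq _] := sublinear_ray y qs.
  rewrite -{1}(qmin _ ps pq) -lerBrDr; apply: ge_inf.
    by exists (- q (- x)); exact: ray_cone_lbound.
  by exists 1 => //; rewrite scale1r mul1r.
have opp x : q (- x) = - q x.
  by have := add x (- x); rewrite subrr (sublinear0 qs); lra.
move=> a x y; rewrite add; congr (_ + _).
case: (ltgtP a 0) => [a0|a0|->]; last 2 first.
- exact: sublinearZ.
- by rewrite scale0r mul0r (sublinear0 qs).
have na0 : 0 < - a by rewrite oppr_gt0.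
by rewrite -[a in LHS]opprK scaleNr opp (sublinearZ _ qs na0); ring.
Qed.

(** Zorn's lemma: the pointwise infimum of a chain is again sublinear, being
    bounded below by - p (- x). *)
Lemma minimal_sublinear_exists p : sublinear p ->
  exists q, [/\ sublinear q, forall x, q x <= p x &
    forall q', sublinear q' -> (forall x, q' x <= q x) -> q' = q].
Proof.
move=> ps.
pose below q := sublinear q /\ forall x, q x <= p x.
pose T := {q | below q}.
pose le (s t : T) := `[< forall x, sval t x <= sval s x >].
have [| | | |[q [qs qp]] qmin] := @Zorn T le.
- by move=> t; apply/asboolP.
- move=> r s t /asboolP rs /asboolP st; apply/asboolP => x.
  exact: le_trans (st x) (rs x).
- move=> [s hs] [t ht] /asboolP/= st /asboolP/= ts.
  by apply: eq_exist; apply/funext => x; apply/eqP; rewrite eq_le ts st.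
- move=> A Atot; have [[q0 Aq0]|A0] := pselect (A !=set0); last first.
    by exists (exist below p (conj ps (fun x => lexx (p x)))) => s As; case: A0; exists s.
  pose K x : set R := [set r | exists2 q : T, A q & sval q x <= r].
  have Klb x : lbound (K x) (- p (- x)).
    move=> r [[q [qs qp]] _ /=]; apply: le_trans.
    by apply: le_trans (sublinear_ge x qs); rewrite lerN2.
  have Kinf : sublinear (fun x => inf (K x)).
    apply: (@sublinear_inf _ (fun x => - p (- x))).
    + by move=> x; exists (sval q0 x), q0.
    + by move=> x r; exact: Klb.
    + move=> x y r s [q1 Aq1 h1] [q2 Aq2 h2].
      have {Atot} [/asboolP h|/asboolP h] := Atot _ _ Aq1 Aq2.
      * exists q2 => //; have [[+ _] _] := svalP q2 => /(_ x y).
        by have := h x; lra.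
      * exists q1 => //; have [[+ _] _] := svalP q1 => /(_ x y).
        by have := h y; lra.
    + move=> t x r t0 [q1 Aq1 h1]; exists q1 => //.
      have [qs _] := svalP q1.
      by rewrite (sublinearZ _ qs)// ler_pM2l.
  have Kp x : inf (K x) <= p x.
    apply: (ge_inf (ex_intro _ _ (@Klb x))); exists q0 => //.
    by have [_] := svalP q0; exact.
  exists (exist below _ (conj Kinf Kp)) => s As; apply/asboolP => x /=.
  by apply: (ge_inf (ex_intro _ _ (@Klb x))); exists s.
exists q; split=> // q' q's q'q.
have q'p x : q' x <= p x by exact: le_trans (q'q x) (qp x).
by have /(congr1 sval) := qmin (exist below q' (conj q's q'p)) ltac:(by apply/asboolP).
Qed.

(** Hahn-Banach: a minimal sublinear functional below p is linear, and if p is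
    first lowered along the ray of x0, its value at - x0 is at most - p x0. *)
Lemma sublinear_support p x0 : sublinear p ->
  exists f : {linear E -> R^o}, (forall x, f x <= p x) /\ f x0 = p x0.
Proof.
move=> ps; have [p's p'p p'x0] := sublinear_ray x0 ps.
have [q [qs qp' qmin]] := minimal_sublinear_exists p's.
have qlin := minimal_sublinear_linear qs qmin.
pose lin := GRing.isLinear.Build R E R^o *:%R (q : E -> R^o) qlin.
pose f : {linear E -> R^o} := HB.pack (q : E -> R^o) lin.
have fp x : f x <= p x by exact: le_trans (qp' x) (p'p x).
exists f; split=> //; apply/eqP; rewrite eq_le fp/=.
have fN : f (- x0) = - f x0 by exact: linearN.
have := le_trans (qp' (- x0)) p'x0.
by rewrite [X in X <= _ -> _]fN lerN2.
Qed.

End sublinear_functionals.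

Lemma convex_setP {R : realType} (E : lmodType R) (A : set E) : convex_set A <->
  (forall x y t, 0 <= t <= 1 -> A x -> A y -> A (t *: x + (1 - t) *: y)).
Proof.
split=> [cA x y t t01 Ax Ay|cA x y t /set_mem Ax /set_mem Ay].
  have [t0 t1] := andP t01.
  have /set_mem := cA x y (Itv01 t0 t1) (mem_set Ax) (mem_set Ay); exact.
apply/mem_set; apply: (cA x y t%:num) => //.
by apply/andP; split.
Qed.

Lemma eval_continuous (I : Type) (T : topologicalType) (i : I) :
  continuous (fun h : {ptws I -> T} => h i).
Proof.
move=> h; have /cvg_sup/(_ i) hi : nbhs h --> h by exact: cvg_id.
apply: cvg_trans (@initial_continuous (I -> T) T (fun f => f i) h).
by move=> A; exact: hi.
Qed.

Section mazur.
Context {R : realType} {E : tvsType R}.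
Implicit Types (A B : set E) (x y : E).

(** Continuity of the scaling at 0. *)
Lemma nbhs0_absorbing B x : nbhs 0 B ->
  exists2 e : R, 0 < e & forall t, `|t| < e -> B (t *: x).
Proof.
move=> B0; have := @scale_continuous R E (0, x) B; rewrite /= scale0r => /(_ B0).
move=> [[P Q]/= [/nbhs_ballP[e /= e0 eP] Qx] PQ].
exists e => // t te; apply: (PQ (t, x)); split => /=; last exact: nbhs_singleton.
by apply: eP; rewrite /ball/= sub0r normrN.
Qed.

Lemma nbhs0_shift A x : nbhs x A -> nbhs 0 [set y | A (x + y)].
Proof.
move=> Ax; have := @add_continuous E (x, 0) A; rewrite /= addr0 => /(_ Ax).
move=> [[P Q]/= [/nbhs_singleton Px Q0] PQ].
by apply: filterS Q0 => y Qy; exact: (PQ (x, y)).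
Qed.

Definition gauge B x : R :=
  inf [set r | 0 < r /\ exists2 b, B b & x = r *: b].

Lemma gauge_set_neq0 B x : nbhs 0 B ->
  [set r | 0 < r /\ exists2 b, B b & x = r *: b] !=set0.
Proof.
move=> B0; have [e e0 /(_ (e / 2))Be] := nbhs0_absorbing x B0.
exists ((e / 2)^-1); split; first by rewrite invr_gt0 divr_gt0.
exists ((e / 2) *: x); first by apply: Be; rewrite ger0_norm ?divr_ge0 1?ltW//; lra.
by rewrite scalerA mulVf ?scale1r//; lra.
Qed.

(** Dividing a sum r b + s c of two multiples by r + s gives a convex combination
    of b and c. *)
Lemma gauge_sublinear B : convex_set B -> nbhs 0 B -> sublinear (gauge B).
Proof.
move=> /convex_setP cB B0; apply: (@sublinear_inf _ _ _ (fun=> 0)).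
- by move=> x; exact: gauge_set_neq0.
- by move=> x r [/ltW].
- move=> x y r s [r0 [b Bb ->]] [s0 [c Bc ->]]; split; first exact: addr_gt0.
  have rs0 : 0 < r + s by exact: addr_gt0.
  exists ((r / (r + s)) *: b + (1 - r / (r + s)) *: c).
    apply: cB => //; apply/andP; split; first by rewrite divr_ge0// ltW.
    by rewrite ler_pdivrMr//; lra.
  by rewrite scalerDr !scalerA; congr (_ *: _ + _ *: _); field; lra.
- move=> t x r t0 [r0 [b Bb ->]]; split; first exact: mulr_gt0.
  by exists b => //; rewrite scalerA.
Qed.

Lemma gauge_le1 B x : B x -> gauge B x <= 1.
Proof.
move=> Bx; apply: ge_inf; first by exists 0 => r [/ltW].
by split=> //; exists x; rewrite ?scale1r.
Qed.

Lemma gauge_ge1 B x : convex_set B -> nbhs 0 B -> ~ B x -> 1 <= gauge B x.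
Proof.
move=> /convex_setP cB B0 nBx; apply: lb_le_inf.
  exact: gauge_set_neq0.
move=> r [r0 [b Bb xE]]; rewrite leNgt; apply/negP => r1; apply: nBx.
have := cB b 0 r; rewrite scaler0 addr0 -xE; apply=> //.
  by rewrite !ltW.
exact: nbhs_singleton.
Qed.

Lemma linear_bounded_continuous (f : {linear E -> R^o}) B :
  nbhs 0 B -> (forall x, B x -> f x <= 1) -> continuous f.
Proof.
move=> B0 fB x; apply/cvgrPdist_le => /= e e0.
have BV : nbhs 0 [set y | B (e^-1 *: y) /\ B (- e^-1 *: y)].
  have sc t : nbhs 0 [set y | B (t *: y)].
    have := @scale_continuous R E (t, 0) B; rewrite /= scaler0 => /(_ B0).
    move=> [[P Q]/= [/nbhs_singleton Pt Q0] PQ].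
    by apply: filterS Q0 => y Qy; exact: (PQ (t, y)).
  by apply: filterI; exact: sc.
have : nbhs x [set z | [set y | B (e^-1 *: y) /\ B (- e^-1 *: y)] (z - x)].
  have := @add_continuous E (x, - x).
  rewrite /continuous_at/= subrr => /(_ _ BV)[[P Q]/= [Px /nbhs_singleton Q0] PQ].
  by apply: filterS Px => y Py; exact: (PQ (y, - x)).
have fE t z : f (t *: (z - x)) = t * (f z - f x) :> R.
  by rewrite linearZ/= linearB.
apply: filterS => z /= [/fB + /fB]; rewrite !fE.
have h (d : R) : e^-1 * d <= 1 -> d <= e.
  by rewrite mulrC ler_pdivrMr// mul1r.
by rewrite mulNr -mulrN opprB => /h h1 /h h2; rewrite ler_norml lerNl opprB h1.
Qed.

(** Let x + U be a convex neighbourhood of x that misses A, and a0 a point of A.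
    Then x - a0 is outside the convex neighbourhood B = A - a0 - U of 0, so that
    the gauge of B is at least 1 there, and a linear functional dominated by the
    gauge separates x from A. The gap s comes from a small multiple of x - a0
    that belongs to - U. *)
Lemma closed_convex_separation A x : closed A -> convex_set A -> A !=set0 ->
  ~ A x -> exists f : {linear E -> R^o}, continuous f /\
  exists2 s, 0 < s & forall a, A a -> f a <= f x - s.
Proof.
move=> clA /convex_setP cA [a0 Aa0] nAx.
have [U [U0 cU UA]] : exists U, [/\ nbhs 0 U, convex_set U &
    forall u, U u -> ~ A (x + u)].
  have : nbhs 0 [set u | (~` A) (x + u)].
    by apply: nbhs0_shift; apply: open_nbhs_nbhs; split => //; exact: closed_openC.
  have [B cB [Bo]] := @locally_convex R E.
  move=> /[apply] -[U /= [BU U0] UA]; exists U; split => //.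
    by apply: open_nbhs_nbhs; split => //; exact: Bo.
  by apply: cB; exact/mem_set.
pose B := [set y | exists a u, [/\ A a, U u & y = a - a0 - u]].
have cB : convex_set B.
  apply/convex_setP => y1 y2 t t01 [a1 [u1 [Aa1 Uu1 ->]]] [a2 [u2 [Aa2 Uu2 ->]]].
  exists (t *: a1 + (1 - t) *: a2), (t *: u1 + (1 - t) *: u2); split.
  - exact: cA.
  - by move/convex_setP: cU; exact.
  - rewrite !scalerBr opprD addrACA; congr (_ + _).
    rewrite addrACA -opprD -scalerDl [t + _]addrC subrK scale1r //.
have B0 : nbhs 0 B.
  have : nbhs 0 [set y | U (- y)].
    by have := @opp_continuous E 0 U; rewrite oppr0; exact.
  apply: filterS => y Uy; exists a0, (- y); split => //.
  by rewrite subrr opprK add0r.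
have nBx : ~ B (x - a0).
  move=> [a [u [Aa Uu xE]]]; apply: (UA u Uu).
  have -> : x = a - u by apply: (addIr (- a0)); rewrite xE addrAC.
  by rewrite subrK.
have [f [fp fx]] := sublinear_support (x - a0) (gauge_sublinear cB B0).
have fB y : B y -> f y <= 1 by move=> /gauge_le1; exact: le_trans (fp y).
have f1 : 1 <= f (x - a0) by rewrite fx; exact: gauge_ge1.
exists f; split; first exact: linear_bounded_continuous fB.
have [e e0 Ue] := nbhs0_absorbing (x - a0) U0.
have fx0 : 0 < f (x - a0) by exact: lt_le_trans f1.
exists (e / 2 * f (x - a0)); first by rewrite mulr_gt0// divr_gt0.
move=> a Aa; have : B (a - a0 - (- (e / 2)) *: (x - a0)).
  exists a, ((- (e / 2)) *: (x - a0)); split => //.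
  by apply: Ue; rewrite normrN ger0_norm ?divr_ge0 1?ltW//; lra.
have fBE y z : f (y - z) = f y - f z :> R by exact: linearB.
have fZE t y : f (t *: y) = t * f y :> R by exact: linearZ.
move=> /fB; rewrite !(fBE, fZE).
by move: f1; rewrite fBE; lra.
Qed.

Lemma topdual_weak_continuous (f : topdual E) :
  continuous (sval f : weak E -> R^o).
Proof.
move=> x; pose ev (y : E) : {ptws topdual E -> R^o} := fun g => sval g y.
apply: (@continuous_comp (weak E) _ _ ev (fun h : {ptws topdual E -> R^o} => h f)).
  exact: initial_continuous.
exact: eval_continuous.
Qed.

(** Mazur: away from a closed convex set A, one of the functionals that
    separate a point from A gives a weak neighbourhood missing A. *)
Lemma closed_convex_weakly_closed A : closed A -> convex_set A ->
  closed (A : set (weak E)).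
Proof.
move=> clA cA; have [A0|A0] := pselect (A !=set0); last first.
  suff -> : A = set0 by exact: closed0.
  by apply/seteqP; split=> x // Ax; apply: A0; exists x.
move=> x clx; apply: contrapT => nAx.
have [f [fc [s s0 fs]]] := closed_convex_separation clA cA A0 nAx.
have : nbhs (x : weak E) [set y | f x - s < f y].
  have /= := @topdual_weak_continuous (exist _ f fc) x [set r | f x - s < r].
  by apply; apply: lt_nbhsr; lra.
by move=> /clx[y [/fs]] /=; lra.
Qed.

End mazur.

(** * Projections in a Hilbert space *)

Section hilbert.
Context {R : realType} {H : completeNormedModType R}.
Context (dot : {dot H for idfun}).
Context (dot_norm : forall u : H, dot u u = `|u| ^+ 2).
Implicit Types (u v w p q : H) (A B C : set H).

Lemma dotC u v : dot u v = dot v u.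
Proof. by rewrite (hermC dot) expr0 mul1r. Qed.

Lemma dotDl u v w : dot (u + v) w = dot u w + dot v w.
Proof. exact: linearDl. Qed.

Lemma dotDr u v w : dot w (u + v) = dot w u + dot w v.
Proof. exact: linearDr. Qed.

Lemma dotNl u w : dot (- u) w = - dot u w.
Proof. exact: linearNl. Qed.

Lemma dotNr u w : dot w (- u) = - dot w u.
Proof. exact: linearNr. Qed.

Lemma dotBl u v w : dot (u - v) w = dot u w - dot v w.
Proof. exact: linearBl. Qed.

Lemma dotBr u v w : dot w (u - v) = dot w u - dot w v.
Proof. exact: linearBr. Qed.

Lemma dotZl a u w : dot (a *: u) w = a * dot u w.
Proof. exact: linearZl_LR. Qed.

Lemma dotZr a u w : dot w (a *: u) = a * dot w u.
Proof. exact: linearZr_LR. Qed.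

Definition dotE := (dotDl, dotDr, dotNl, dotNr, dotZl, dotZr).

Lemma normD2 u v : `|u + v| ^+ 2 = `|u| ^+ 2 + 2 * dot u v + `|v| ^+ 2.
Proof. by rewrite -!dot_norm !dotE (dotC v u); ring. Qed.

Lemma normB2 u v : `|u - v| ^+ 2 = `|u| ^+ 2 - 2 * dot u v + `|v| ^+ 2.
Proof. by rewrite normD2 dotNr normrN mulrN. Qed.

(** The triangle inequality for u + v, squared. *)
Lemma dot_le_norm u v : dot u v <= `|u| * `|v|.
Proof.
have : `|u + v| ^+ 2 <= (`|u| + `|v|) ^+ 2 by rewrite lerXn2r ?nnegrE// ?addr_ge0// ler_normD.
by rewrite normD2; nra.
Qed.

Lemma norm_dot_le u v : `|dot u v| <= `|u| * `|v|.
Proof.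
rewrite ler_norml dot_le_norm andbT lerNl -dotNl.
by apply: le_trans (dot_le_norm _ _) _; rewrite normrN.
Qed.

Lemma dot_continuous v : continuous (fun u => dot u v : R^o).
Proof.
move=> u; apply/cvgrPdist_le => /= e e0.
have v1 : 0 < `|v| + 1 by rewrite ltr_wpDl.
apply/nbhs_ballP; exists (e / (`|v| + 1)) => /=; first exact: divr_gt0.
move=> w; rewrite -ball_normE /= => uw; rewrite -dotBl.
apply: le_trans (norm_dot_le _ _) _.
have [n1 n2] := (normr_ge0 (u - w), normr_ge0 v).
move: uw; rewrite ltr_pdivlMr//; nra.
Qed.

Section projection.
Context (C : set H) (C0 : C !=set0) (C_closed : closed C).
Context (C_convex : convex_set C).

(** The parallelogram identity makes the almost nearest points of C a Cauchy
    filter base. *)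
Lemma nearest_point_exists u :
  exists p, C p /\ forall q, C q -> `|u - p| <= `|u - q|.
Proof.
pose d := inf [set `|u - q| ^+ 2 | q in C].
have dP q : C q -> d <= `|u - q| ^+ 2.
  by move=> Cq; apply: ge_inf; [exists 0 => _ [r _ <-]; exact: sqr_ge0|exists q].
pose near e : set H := C `&` [set q | `|u - q| ^+ 2 <= d + e].
pose F := filter_from [set e : R | 0 < e] near.
have FF : ProperFilter F.
  have hinf : has_inf [set `|u - q| ^+ 2 | q in C].
    split; first by have [q Cq] := C0; exists (`|u - q| ^+ 2), q.
    by exists 0 => _ [r _ <-]; exact: sqr_ge0.
  apply: filter_from_proper => [|e e0].
    apply: filter_from_filter; first by exists 1 => /=.
    move=> e1 e2 e10 e20; exists (Num.min e1 e2); first by rewrite /= lt_min e10.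
    move=> q [Cq]; rewrite /= -lerBlDl le_min => /andP[h1 h2].
    by split; split => //=; lra.
  have [_ [q Cq <-] qe] := inf_adherent e0 hinf.
  by exists q; split => //=; exact: ltW.
have Fcauchy : cauchy F.
  apply/cauchy_exP => e e0; have e0W := ltW e0.
  have e0' : 0 < (e / 4) ^+ 2 by rewrite exprn_gt0// divr_gt0.
  have [q [Cq qe]] : near ((e / 4) ^+ 2) !=set0.
    by apply: (@filter_ex _ F); exists ((e / 4) ^+ 2).
  exists q; exists ((e / 4) ^+ 2) => // r [Cr re].
  rewrite -ball_normE /=.
  rewrite -(@ltr_pXn2r _ 2) ?nnegrE//.
  have Cm : C ((1 / 2) *: q + (1 - 1 / 2) *: r).
    by move/convex_setP: C_convex; apply => //; apply/andP; split; lra.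
  move: (dP _ Cm) qe re; rewrite /= -!dot_norm !dotE => h1 h2 h3.
  move: h1 h2 h3; rewrite (dotC q u) (dotC r u) (dotC r q); nra.
have Fp := @cauchy_cvg H F FF Fcauchy; set p := lim F in Fp.
have nearp e : 0 < e -> near e p.
  move=> e0; have cl : closed (near e).
    apply: closedI => //.
    apply: (@preimage_closed _ _ (fun q => `|u - q| ^+ 2) [set r | r <= d + e]).
      2: exact: closed_le.
    move=> q _; apply: (@continuous_comp _ _ _ (fun q => `|u - q|) (fun r : R => r ^+ 2)).
      apply: continuous_comp; last exact: norm_continuous.
      by apply: continuousB; [exact: cst_continuous|exact: id].
    exact: exprn_continuous.
  by apply: (@closed_cvg H H F FF id _ cl _ p Fp); exists e.
exists p; split; first by have [] := nearp 1 ltr01.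
move=> q Cq; rewrite -(@ler_pXn2r _ 2) ?nnegrE//.
apply/ler_addgt0Pr => e e0; have [_ /=] := nearp _ e0.
by move/le_trans; apply; rewrite lerD2r dP.
Qed.

Local Notation P := (orth_proj C).

Lemma orth_projP u : C (P u) /\ forall q, C q -> `|u - P u| <= `|u - q|.
Proof. exact: (getPex (nearest_point_exists u)). Qed.

Lemma orth_proj_mem u : C (P u).
Proof. by have [] := orth_projP u. Qed.

Lemma orth_proj_le u q : C q -> `|u - P u| <= `|u - q|.
Proof. by have [_] := orth_projP u; exact. Qed.

Lemma orth_proj_dot_le0 u q : C q -> dot (u - P u) (q - P u) <= 0.
Proof.
move=> Cq; rewrite leNgt; apply/negP => s0.
set s := dot _ _ in s0; set D := `|q - P u| ^+ 2.
have D0 : 0 <= D by exact: sqr_ge0.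
have sD0 : 0 < s + D by exact: ltr_wpDr.
(* Moving from P u towards q by s / D would be optimal; this smaller t also
   lies in `[0, 1]. *)
pose t := s / (s + D).
have t0 : 0 < t by exact: divr_gt0.
have Ct : C (t *: q + (1 - t) *: P u).
  move/convex_setP: C_convex; apply => //; last exact: orth_proj_mem.
  by rewrite ltW//= ler_pdivrMr//; lra.
have := orth_proj_le u Ct.
rewrite -(@ler_pXn2r _ 2) ?nnegrE//.
have -> : u - (t *: q + (1 - t) *: P u) = (u - P u) - t *: (q - P u).
  by rewrite scalerBl scale1r scalerBr addrCA opprD addrA.
rewrite [leRHS]normB2 dotZr -/s normrZ exprMn -/D (gtr0_norm t0) => h.
have tE : t * (s + D) = s by rewrite divfK// gt_eqF.
by have : t * (t * D - 2 * s) >= 0; [lra|]; rewrite pmulr_rge0//; nra.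
Qed.

Lemma orth_proj_unique u q : C q -> `|u - q| <= `|u - P u| -> q = P u.
Proof.
move=> Cq; rewrite -(@ler_pXn2r _ 2) ?nnegrE//.
have -> : u - q = (u - P u) - (q - P u) by rewrite opprB addrA subrK.
rewrite normB2; have := orth_proj_dot_le0 u Cq.
have := sqr_ge0 `|q - P u| => h1 h2 h3.
have : `|q - P u| ^+ 2 = 0 by lra.
by move=> /eqP; rewrite sqrf_eq0 normr_eq0 subr_eq0 => /eqP.
Qed.

Lemma orth_proj_id u : C u -> P u = u.
Proof. by move=> Cu; apply/esym/orth_proj_unique => //; rewrite subrr normr0. Qed.

Lemma orth_proj_nonexpansive u v : `|P u - P v| <= `|u - v|.
Proof.
have := orth_proj_dot_le0 u (orth_proj_mem v).
have := orth_proj_dot_le0 v (orth_proj_mem u) => h1 h2.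
have h3 : `|P u - P v| ^+ 2 <= `|u - v| * `|P u - P v|.
  apply: le_trans (dot_le_norm _ _); move: h1 h2.
  by rewrite -dot_norm !dotE (dotC (P v) (P u)); lra.
have [->//|n0] := eqVneq `|P u - P v| 0.
have n1 : 0 < `|P u - P v| by rewrite lt_neqAle eq_sym n0/=.
by move: h3; rewrite expr2 ler_pM2r.
Qed.

End projection.

(** For x in A, the projection of P_B x onto A stays in B and is at least as
    close to x as P_B x, so that P_B x is already in A. *)
Lemma orth_proj_exchange A B : A !=set0 -> closed A -> convex_set A ->
  B !=set0 -> closed B -> convex_set B ->
  orth_proj A @` B `<=` B -> orth_proj B @` A `<=` A.
Proof.
move=> A0 cA vA B0 cB vB AB _ [x Ax <-].
have By := orth_proj_mem B0 cB vB x.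
rewrite -(@orth_proj_unique B B0 cB vB x (orth_proj A (orth_proj B x))).
- exact: orth_proj_mem.
- by apply: AB; exists (orth_proj B x).
- rewrite -{1}(orth_proj_id A0 cA vA Ax) [leRHS]distrC distrC.
  exact: orth_proj_nonexpansive.
Qed.

End hilbert.

(** * Subgradients, resolvents and weak compactness *)

Section convex_functionals.
Context {R : realType} {H : completeNormedModType R}.
Context (dot : {dot H for idfun}).
Context {V : lmodType R} (phi : V -> \bar R) (j : {linear V -> H}).
Context (phi_ninfty : ninfty_free phi) (phi_convex : convex_functional phi).
Implicit Types (x y w : V) (u f : H).

Lemma functional_fin_or_pinfty x : (exists r, phi x = r%:E) \/ phi x = +oo%E.
Proof.
by have := phi_ninfty x; case: (phi x) => [r|//|//] _; [left; exists r|right].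
Qed.

Lemma effdom_fin x : effdom phi x -> exists r, phi x = r%:E.
Proof. by rewrite /effdom /=; case: (functional_fin_or_pinfty x) => // ->. Qed.

Lemma convex_functional_fin x y t r s : 0 <= t <= 1 -> phi x = r%:E ->
  phi y = s%:E -> (phi (t *: x + (1 - t) *: y)%R <= (t * r + (1 - t) * s)%:E)%E.
Proof. by move=> t01 xr ys; have := phi_convex x y t01; rewrite xr ys. Qed.

(** Difference quotients of a convex functional are nondecreasing in the step,
    so that the lower limit defining the subgradient may be replaced by the
    quotient at step 1. *)
Lemma jsubgradientP u f : jsubgradient dot phi j (u, f) <->
  exists x r, [/\ phi x = r%:E, j x = u &
    forall w s, phi w = s%:E -> r + dot f (j w - u) <= s].
Proof.
split=> [[x [/effdom_fin[r xr] /= jx xf]]|[x [r [xr jx xf]]]].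
  exists x, r; split=> // w s ws.
  rewrite addrC -lerBrDr -jx -linearB -lee_fin.
  apply: le_trans (xf _) _; rewrite limf_einfE; apply: ge_ereal_sup => _ [A A0 <-].
  have [t [At t0 t1]] : exists t, [/\ A t, 0 < t & t <= 1].
    have := @filter_ex _ (0%R : R)^'+ _ [set t | [/\ A t, 0 < t & t <= 1]].
    apply; near=> t; split; near: t => //; [exact: nbhs_right_gt|].
    by apply: nbhs_right_le; exact: ltr01.
  apply: (le_trans (ereal_inf_lbound _)); first by exists t; [exact: At|reflexivity].
  have -> : x + t *: (w - x) = t *: w + (1 - t) *: x.
    by rewrite scalerBr scalerBl scale1r addrCA.
  have := @convex_functional_fin w x t s r _ ws xr; rewrite (ltW t0) t1 => /(_ isT).
  rewrite xr; case: (functional_fin_or_pinfty (t *: w + (1 - t) *: x)) => [[q ->]|->//].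
  rewrite lee_fin -EFinB -EFinM lee_fin => h.
  by rewrite ler_pdivrMr//; lra.
exists x; split => /=; [by rewrite /effdom /= xr ltry|by []|move=> v].
rewrite limf_einfE; apply: ereal_sup_ge.
eexists; first by exists [set t : R | 0 < t]; [exact: nbhs_right_gt|reflexivity].
apply: le_ereal_inf_tmp => _ [t /= t0 <-].
rewrite xr; case: (functional_fin_or_pinfty (x + t *: v)) => [[q qE]|->]; last first.
  by rewrite addye// gt0_mulye ?leey// lte_fin invr_gt0.
rewrite qE -EFinB -EFinM lee_fin ler_pdivlMr//.
have := xf _ _ qE.
have -> : j (x + t *: v) - u = t *: j v.
  by rewrite linearD/= linearZ/= jx addrAC subrr add0r.
by rewrite dotZr mulrC; lra.
Unshelve. all: by end_near. Qed.

End convex_functionals.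

Lemma le_of_forall_shrink (R : realFieldType) (a b d : R) :
  (forall t, 0 < t -> t <= 1 -> a <= b + t * d) -> a <= b.
Proof.
move=> h; rewrite leNgt; apply/negP => ba.
have d0 := normr_ge0 d; have dd := ler_norm d.
have e0 : 0 < a - b + `|d| by lra.
pose t := (a - b) / (a - b + `|d|) / 2.
have t0 : 0 < t by rewrite !divr_gt0//; lra.
have tE : t * (a - b + `|d|) * 2 = a - b by rewrite /t; field; lra.
have t1 : t <= 1 by nra.
have := h t t0 t1; nra.
Qed.

Section weak_compactness.
Context {R : realType} {V : tvsType R}.

(** The sets F i form a filter base on a compact set, and its cluster points
    belong to all of them. *)
Lemma precompact_directed_intersection (A : set V) (I : Type) (D : set I)
    (F : I -> set V) :
  precompact (A : set (weak V)) -> D !=set0 ->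
  (forall i, D i -> F i !=set0) ->
  (forall i, D i -> closed (F i : set (weak V))) ->
  (forall i, D i -> F i `<=` A) ->
  (forall i k, D i -> D k -> exists2 l, D l & F l `<=` F i `&` F k) ->
  exists x, forall i, D i -> F i x.
Proof.
move=> [B AB [cB _]] [i0 Di0] F0 Fcl FA Fdir.
have FF : @ProperFilter (weak V) (filter_from D F).
  apply: filter_from_proper => //; apply: filter_from_filter => //.
  by exists i0.
have [|x [Bx clx]] := cB _ FF.
  by exists i0 => //; apply: subset_trans (FA _ Di0) _ => y; exact: AB.
exists x => i Di; apply: (Fcl _ Di) => U Ux.
by apply: clx => //; exists i.
Qed.

End weak_compactness.

Section penalization.
Context {R : realType} {V : tvsType R} {H : completeNormedModType R}.
Context (dot : {dot H for idfun}).
Context (dot_norm : forall u : H, dot u u = `|u| ^+ 2).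
Context (j : {linear V -> H}) (j_cont : weak_continuous j).
Context (phi : V -> \bar R) (phi_ninfty : ninfty_free phi).
Context (phi_convex : convex_functional phi) (phi_lsc : lower_semicontinuous phi).
Implicit Types (u f : H) (k c : R).

(** For k = 1 / (2 lambda) the minimizers are the preimages under j of the
    resolvent at u. *)
Definition penalized k u x : \bar R := (phi x + (k * `|j x - u| ^+ 2)%:E)%E.

(** The sublevels of phi are convex, so that Mazur's theorem applies. *)
Lemma sublevel_weakly_closed c : closed (sublevel phi c : set (weak V)).
Proof.
apply: closed_convex_weakly_closed.
  by move/lower_semicontinuous_sublevel: phi_lsc; exact.
apply/convex_setP => x y t t01; rewrite /sublevel /=.
case: (functional_fin_or_pinfty phi_ninfty x) => [[r xr]|->//].
case: (functional_fin_or_pinfty phi_ninfty y) => [[s ys]|->//].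
rewrite xr ys !lee_fin => rc sc.
apply: le_trans (convex_functional_fin phi_convex t01 xr ys) _.
by rewrite lee_fin; have [t0 t1] := andP t01; nra.
Qed.

Lemma dot_j_weakly_continuous h :
  continuous (fun x : weak V => dot (j x) h : R^o).
Proof.
pose lin := GRing.isLinear.Build R H R^o *:%R (fun u => dot u h : R^o)
  (fun a u v => etrans (dotDl dot (a *: u) v h) (congr1 (+%R^~ _) (dotZl dot a u h))).
pose f : {linear H -> R^o} := HB.pack (fun u => dot u h : R^o) lin.
have fc : continuous f by exact: dot_continuous dot_norm h.
move=> x; apply: (@continuous_comp (weak V) (weak H) _ j f); first exact: j_cont.
exact: (@topdual_weak_continuous R H (exist _ f fc)).
Qed.

(** Above a point x the squared norm is bounded below by its affine tangent,
    which is weakly continuous. *)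
Lemma penalized_weakly_closed k u c : 0 <= k ->
  closed (sublevel (penalized k u) c : set (weak V)).
Proof.
move=> k0 x clx; rewrite /sublevel /= leNgt; apply/negP => xc.
set h := j x - u.
have [a xa ac] : exists2 a, (a%:E < phi x)%E & c - a < k * `|h| ^+ 2.
  move: xc; rewrite /penalized -/h.
  case: (functional_fin_or_pinfty phi_ninfty x) => [[r ->]|->].
    rewrite -EFinD lte_fin => xc; exists (r - (r + k * `|h| ^+ 2 - c) / 2); last lra.
    by rewrite lte_fin; lra.
  by move=> _; exists (c - k * `|h| ^+ 2 + 1); [rewrite ltry|lra].
have Ux : nbhs (x : weak V) (~` sublevel phi a).
  apply: open_nbhs_nbhs; split.
    by apply: (@closed_openC (weak V)); exact: sublevel_weakly_closed.
  by rewrite /sublevel /= => /le_lt_trans/(_ xa); rewrite ltxx.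
have Wx : nbhs (x : weak V)
    [set y | c - a < k * (2 * (dot (j y) h - dot u h) - `|h| ^+ 2)].
  have gc : {for (x : weak V), continuous (fun y : weak V =>
      (k * (2 * (dot (j y) h - dot u h) - `|h| ^+ 2) : R^o))}.
    apply: continuousM; first exact: cst_continuous.
    apply: continuousB; last exact: cst_continuous.
    apply: continuousM; first exact: cst_continuous.
    apply: continuousB; last exact: cst_continuous.
    exact: dot_j_weakly_continuous.
  have /= := gc [set r | c - a < r]; apply; apply: lt_nbhsr.
  by rewrite -dotBl -/h dot_norm; lra.
have [y [yc [ya /= yW]]] := clx _ (filterI Ux Wx); apply: ya.
move: yc; rewrite /sublevel /= /penalized.
case: (functional_fin_or_pinfty phi_ninfty y) => [[r ->]|->//].
rewrite -EFinD !lee_fin => yc.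
have sq : 2 * (dot (j y) h - dot u h) - `|h| ^+ 2 <= `|j y - u| ^+ 2.
  have := sqr_ge0 `|(j y - u) - h|.
  by rewrite (normB2 dot_norm) dotBl; lra.
nra.
Qed.

Section elliptic.
Context (omega : R) (omega0 : 0 <= omega).
Let phi_omega x := (phi x + (omega / 2 * `|j x| ^+ 2)%:E)%E.
Context (phi_omega_coercive : coercive phi_omega).
Context (phi_proper : proper_functional phi).

Lemma normj_le x u : `|j x| ^+ 2 <= 2 * `|j x - u| ^+ 2 + 2 * `|u| ^+ 2.
Proof.
have := sqr_ge0 `|(j x - u) - u|; rewrite (normB2 dot_norm).
by have := normD2 dot_norm (j x - u) u; rewrite subrK => ->; lra.
Qed.

Lemma penalized_sublevel_large k u c : omega <= k ->
  sublevel (penalized k u) c `<=` sublevel phi_omega (c + omega * `|u| ^+ 2).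
Proof.
move=> ok x; rewrite /sublevel /= /penalized /phi_omega.
case: (functional_fin_or_pinfty phi_ninfty x) => [[r ->]|->//].
rewrite -!EFinD !lee_fin => h.
have e1 := ler_wpM2l (divr_ge0 omega0 (ler0n R 2)) (normj_le x u).
have e2 := ler_wpM2r (sqr_ge0 `|j x - u|) ok; lra.
Qed.

(** With an affine minorant in j, any positive penalty controls the norm of
    j x, hence also phi_omega. *)
Lemma penalized_sublevel_minorant k u c f a : 0 < k ->
  (forall x r, phi x = r%:E -> a + dot f (j x) <= r) ->
  exists c', sublevel (penalized k u) c `<=` sublevel phi_omega c'.
Proof.
move=> k0 af; pose B := c - a - dot f u.
pose M := 2 / k * (B + `|f| ^+ 2 / (2 * k)).
exists (c + omega * (M + `|u| ^+ 2)) => x; rewrite /sublevel /= /penalized /phi_omega.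
case: (functional_fin_or_pinfty phi_ninfty x) => [[r xr]|->//].
rewrite xr -!EFinD !lee_fin => h.
have := af _ _ xr; rewrite -[j x in X in X -> _](subrK u (j x)) dotDr => h1.
(* M is the bound that Young's inequality extracts from
   k n^2 <= B + |f| n, where n = |j x - u|. *)
have nM : `|j x - u| ^+ 2 <= M.
  have h2 : - dot f (j x - u) <= `|f| * `|j x - u|.
    by rewrite -dotNl -[in leRHS](normrN f); exact: dot_le_norm.
  set n := `|j x - u| in h h2 *.
  have e1 : k * n ^+ 2 - `|f| * n <= B by rewrite /B; lra.
  have e2 : 0 <= (k * n - `|f|) ^+ 2 by exact: sqr_ge0.
  have -> : M = (2 * k * B + `|f| ^+ 2) / k ^+ 2 by rewrite /M; field; lra.
  rewrite ler_pdivlMr ?exprn_gt0//; nra.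
have e1 := ler_wpM2l (divr_ge0 omega0 (ler0n R 2)) (normj_le x u).
have e2 := ler_wpM2l omega0 nM.
have e3 := mulr_ge0 (ltW k0) (sqr_ge0 `|j x - u|); lra.
Qed.

(** A point common to all nonempty sublevels is a minimizer. *)
Lemma penalized_minimizer k u : 0 <= k ->
  (forall c, exists c', sublevel (penalized k u) c `<=` sublevel phi_omega c') ->
  exists x r, phi x = r%:E /\ forall y s, phi y = s%:E ->
    r + k * `|j x - u| ^+ 2 <= s + k * `|j y - u| ^+ 2.
Proof.
move=> k0 klt; have [x0 /(effdom_fin phi_ninfty)[r0 x0r]] := phi_proper.
pose c0 := r0 + k * `|j x0 - u| ^+ 2.
have x0c : sublevel (penalized k u) c0 x0 by rewrite /sublevel /= /penalized x0r.
have [c' c'P] := klt c0.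
pose D := [set c | c <= c0 /\ sublevel (penalized k u) c !=set0].
have subl c d : c <= d -> sublevel (penalized k u) c `<=` sublevel (penalized k u) d.
  by move=> cd y yc; apply: le_trans yc _; rewrite lee_fin.
have [x xP] : exists x, forall c, D c -> sublevel (penalized k u) c x.
  apply: (precompact_directed_intersection (phi_omega_coercive c')).
  - by exists c0; split=> //; exists x0.
  - by move=> c [].
  - by move=> c _; exact: penalized_weakly_closed.
  - by move=> c [cc0 _]; apply: subset_trans c'P; exact: subl.
  - move=> c d [cc0 cn] [dc0 dn]; exists (Num.min c d).
      split; first by rewrite ge_min cc0.
      by rewrite /Num.min; case: ifP.
    by move=> y ymin; split; apply: subl y ymin; rewrite ge_min lexx ?orbT.
have xc0 : sublevel (penalized k u) c0 x by apply: xP; split=> //; exists x0.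
have [r xr] : exists r, phi x = r%:E.
  move: xc0; rewrite /sublevel /= /penalized.
  by case: (functional_fin_or_pinfty phi_ninfty x) => // ->.
exists x, r; split=> // y s ys.
rewrite -lee_fin; have [yc|/ltW yc] := leP (s + k * `|j y - u| ^+ 2) c0.
  have : sublevel (penalized k u) (s + k * `|j y - u| ^+ 2) x.
    by apply: xP; split=> //; exists y; rewrite /sublevel /= /penalized ys.
  by rewrite /sublevel /= /penalized xr.
move: xc0; rewrite /sublevel /= /penalized xr -EFinD => /le_trans; apply.
by rewrite lee_fin.
Qed.

(** Fermat's rule along segments; the quadratic term has gradient 2 k (j x - u). *)
Lemma penalized_minimizer_subgradient lambda u x r : 0 < lambda ->
  phi x = r%:E -> (forall y s, phi y = s%:E ->
    r + (2 * lambda)^-1 * `|j x - u| ^+ 2 <= s + (2 * lambda)^-1 * `|j y - u| ^+ 2) ->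
  jsubgradient dot phi j (j x, lambda^-1 *: (u - j x)).
Proof.
move=> l0 xr xmin; apply/(jsubgradientP _ _ phi_ninfty phi_convex).
exists x, r; split=> // w s ws.
set k := (2 * lambda)^-1; have kE : lambda^-1 = 2 * k by rewrite /k; field; lra.
have k0 : 0 < k by rewrite invr_gt0; lra.
suff : r - s <= 2 * k * dot (j x - u) (j w - j x).
  by rewrite kE dotZl -[u - _]opprB dotNl; lra.
apply: (@le_of_forall_shrink _ _ _ (k * `|j w - j x| ^+ 2)) => t t0 t1.
have := @convex_functional_fin _ _ _ phi_convex w x t s r _ ws xr.
rewrite (ltW t0) t1 => /(_ isT).
case: (functional_fin_or_pinfty phi_ninfty (t *: w + (1 - t) *: x)) => [[q qE]|->//].
rewrite qE lee_fin => qle; have := xmin _ _ qE; rewrite -/k.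
have -> : j (t *: w + (1 - t) *: x) - u = (j x - u) + t *: (j w - j x).
  by rewrite linearD/= !linearZ/= scalerBl scale1r scalerBr addrCA addrAC.
rewrite (normD2 dot_norm _ (t *: _)) normrZ exprMn (gtr0_norm t0) dotZr => h.
have : t * (r - s) <= t * (2 * k * dot (j x - u) (j w - j x) + t * (k * `|j w - j x| ^+ 2)).
  by lra.
by rewrite ler_pM2l.
Qed.

Lemma resolvent_spec_exists lambda u : 0 < lambda ->
  (forall c, exists c', sublevel (penalized (2 * lambda)^-1 u) c `<=`
     sublevel phi_omega c') ->
  exists v, exists2 f, jsubgradient dot phi j (v, f) & v + lambda *: f = u.
Proof.
move=> l0 lc; have [|x [r [xr xmin]]] := @penalized_minimizer (2 * lambda)^-1 u _ lc.
  by rewrite invr_ge0; lra.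
exists (j x), (lambda^-1 *: (u - j x)).
  exact: penalized_minimizer_subgradient xmin.
by rewrite scalerA divff ?gt_eqF// scale1r addrC subrK.
Qed.

(** A resolvent with a small parameter, for which the penalty alone dominates
    the quadratic term of phi_omega, provides a subgradient of phi. *)
Lemma affine_minorant_exists :
  exists f a, forall x r, phi x = r%:E -> a + dot f (j x) <= r.
Proof.
have o1 : 0 < omega + 1 by exact: ltr_wpDl.
have l0 : 0 < (2 * (omega + 1))^-1 by rewrite invr_gt0 mulr_gt0.
have [|v [f vf _]] := @resolvent_spec_exists _ 0 l0.
  move=> c; exists (c + omega * `|0 : H| ^+ 2); apply: penalized_sublevel_large.
  have -> : (2 * (2 * (omega + 1))^-1)^-1 = omega + 1 by field; rewrite gt_eqF.
  by rewrite lerDl.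
move: vf => /(jsubgradientP _ _ phi_ninfty phi_convex)[x [r [xr jx xf]]].
exists f, (r - dot f v) => y s ys.
by have := xf _ _ ys; rewrite dotBr; lra.
Qed.

Lemma penalized_sublevel k u c : 0 < k ->
  exists c', sublevel (penalized k u) c `<=` sublevel phi_omega c'.
Proof.
by move=> k0; have [f [a fa]] := affine_minorant_exists; exact: penalized_sublevel_minorant fa.
Qed.

Lemma resolventP lambda u : 0 < lambda ->
  exists2 f, jsubgradient dot phi j (resolvent dot phi j lambda u, f) &
    resolvent dot phi j lambda u + lambda *: f = u.
Proof.
move=> l0; apply: (@getPex _ [set v | exists2 f, jsubgradient dot phi j (v, f) & v + lambda *: f = u]).
apply: resolvent_spec_exists => // c; apply: penalized_sublevel.
by rewrite invr_gt0; lra.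
Qed.

Lemma resolvent_ineq lambda u : 0 < lambda ->
  let v := resolvent dot phi j lambda u in
  exists x r, [/\ phi x = r%:E, j x = v &
    forall w s, phi w = s%:E -> r + lambda^-1 * dot (u - v) (j w - v) <= s].
Proof.
move=> l0 v; have [f vf uE] := resolventP u l0.
move: vf => /(jsubgradientP _ _ phi_ninfty phi_convex)[x [r [xr jx xf]]].
exists x, r; split=> // w s ws; have := xf _ _ ws.
have -> : f = lambda^-1 *: (u - v).
  by rewrite -uE -/v addrC addKr scalerA mulVf ?gt_eqF// scale1r.
by rewrite dotZl.
Qed.

End elliptic.
End penalization.

(** * Spline test functions *)

Section spline.
Context {R : realType}.
Implicit Types (x y s t : R).

Lemma is_derive_quadratic_error (f : R -> R) x d :
  (forall y, `|f y - f x - d * (y - x)| <= (y - x) ^+ 2) -> is_derive x 1 f d.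
Proof.
move=> fd.
have lim : h^-1 *: (f (h *: 1 + x) - f x) @[h --> 0^'] --> d.
  apply/cvgrPdist_le => /= e e0; near=> h.
  have h0 : h != 0 by near: h; exact: nbhs_dnbhs_neq.
  have he : `|h| <= e.
    near: h; apply: dnbhs0_le; exact: e0.
  have := fd (h *: 1 + x); rewrite addrK [h *: 1]mulr1 => fdh.
  have -> : d - h^-1 *: (f (h + x) - f x) = - (h^-1 * (f (h + x) - f x - d * h)).
    by rewrite /GRing.scale /=; field.
  rewrite normrN normrM normfV ler_pdivrMl ?normr_gt0//.
  apply: le_trans fdh _; rewrite -[h ^+ 2]real_normK ?num_real// expr2.
  by apply: ler_wpM2l.
by split; [apply/cvg_ex; exists d|exact: cvg_lim lim].
Unshelve. all: by end_near. Qed.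

Definition ramp x := Num.max x 0.

Lemma sqr_ramp_taylor x y :
  `|ramp y ^+ 2 - ramp x ^+ 2 - 2 * ramp x * (y - x)| <= (y - x) ^+ 2.
Proof.
have [h1 h2 h3] : [/\ 0 <= (y - x) ^+ 2, 0 <= x ^+ 2 & 0 <= y ^+ 2].
  by split; exact: sqr_ge0.
rewrite /ramp ler_norml.
case: (leP x 0) => x0; case: (leP y 0) => y0; apply/andP; split; try nra.
Qed.

(** The quadratic B-spline step: a continuously differentiable transition from
    0 to 1 over `[0, 2 * e]. *)
Definition smooth_step (e x : R) :=
  (2 * e ^+ 2)^-1 * (ramp x ^+ 2 - 2 * ramp (x - e) ^+ 2 + ramp (x - 2 * e) ^+ 2).

(** The derivative of smooth_step. *)
Definition tent (e x : R) :=
  (e ^+ 2)^-1 * (ramp x - 2 * ramp (x - e) + ramp (x - 2 * e)).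

Lemma is_derive_sqr_ramp a x :
  is_derive x 1 (fun y => ramp (y - a) ^+ 2) (2 * ramp (x - a)).
Proof.
apply: is_derive_quadratic_error => y.
by have := sqr_ramp_taylor (x - a) (y - a); rewrite opprB addrA subrK.
Qed.

Context (e : R) (e0 : 0 < e).

Lemma is_derive_smooth_step a x : is_derive x 1 (fun y => smooth_step e (y - a)) (tent e (x - a)).
Proof.
have -> : (fun y => smooth_step e (y - a)) = (2 * e ^+ 2)^-1 *:
   ((fun y => ramp (y - a) ^+ 2) - 2 *: (fun y => ramp (y - (a + e)) ^+ 2)
    + (fun y => ramp (y - (a + 2 * e)) ^+ 2)).
  by apply/funext => y; rewrite /smooth_step !fctE /= !opprD !addrA.
have h1 := is_derive_sqr_ramp a x.
have h2 := is_derive_sqr_ramp (a + e) x.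
have h3 := is_derive_sqr_ramp (a + 2 * e) x.
apply: is_derive_eq; rewrite /tent !opprD !addrA /GRing.scale /=.
by field; rewrite gt_eqF.
Qed.

Lemma ramp_continuous : continuous ramp.
Proof.
move=> x; apply: (@continuous_max _ R^o id (cst 0)); [exact: id|exact: cst_continuous].
Qed.

Lemma tent_continuous a : continuous (fun x => tent e (x - a)).
Proof.
have subc b : continuous (fun x : R => x - b).
  by move=> x; apply: cvgB; [exact: cvg_id|exact: cvg_cst].
have rampc b : continuous (fun x : R => ramp (x - a - b)).
  move=> x; apply: (@continuous_comp _ _ _ (fun x => x - a - b) ramp).
    by apply: cvgB; [exact: subc|exact: cvg_cst].
  exact: ramp_continuous.
rewrite /tent => x; apply: cvgM; first exact: cvg_cst.
apply: cvgD; last exact: rampc.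
apply: cvgB; last by apply: cvgM; [exact: cvg_cst|exact: rampc].
apply: (@continuous_comp _ _ _ (fun x => x - a) ramp); first exact: subc.
exact: ramp_continuous.
Qed.

Lemma tent_ge0 x : 0 <= tent e x.
Proof.
rewrite mulr_ge0 ?invr_ge0 ?sqr_ge0// /ramp.
by case: (leP x 0); case: (leP (x - e) 0); case: (leP (x - 2 * e) 0); lra.
Qed.

Lemma tent_eq0 x : ~~ (0 <= x <= 2 * e) -> tent e x = 0.
Proof.
have ep := e0; rewrite negb_and -!ltNge => h; rewrite /tent /ramp; apply/eqP.
rewrite mulf_eq0; apply/orP; right; apply/eqP; case/orP: h => h.
  by case: (leP x 0); case: (leP (x - e) 0); case: (leP (x - 2 * e) 0); lra.
by case: (leP x 0); case: (leP (x - e) 0); case: (leP (x - 2 * e) 0); lra.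
Qed.

Lemma smooth_step_le0 x : x <= 0 -> smooth_step e x = 0.
Proof.
have ep := e0; move=> x0; rewrite /smooth_step /ramp.
by case: (leP x 0); case: (leP (x - e) 0); case: (leP (x - 2 * e) 0); lra.
Qed.

Lemma smooth_step_ge x : 2 * e <= x -> smooth_step e x = 1.
Proof.
have ep := e0; move=> x0; rewrite /smooth_step /ramp !max_l; try lra.
by field; rewrite gt_eqF.
Qed.

Lemma smooth_step_nondecreasing x y : x <= y -> smooth_step e x <= smooth_step e y.
Proof.
move=> xy; rewrite -[x]subr0 -[y]subr0.
have der (z : R) : is_derive z 1 (fun y => smooth_step e (y - 0)) (tent e (z - 0)) by exact: is_derive_smooth_step.
have dz z : derivable (fun y => smooth_step e (y - 0)) z 1.
  exact: (@ex_derive _ _ _ _ _ _ _ (der z)).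
apply: (@ger0_derive1_ndecr R (fun y => smooth_step e (y - 0)) (x - 1) (y + 1)).
- by move=> z _; exact: dz.
- by move=> z _; rewrite derive1E (@derive_val _ _ _ _ _ _ _ (der z)) tent_ge0.
- apply: continuous_subspaceT => z; apply: differentiable_continuous.
  by apply/derivable1_diffP; exact: dz.
- by lra.
- by [].
- by lra.
Qed.

End spline.

(** * Integrated differential inequalities *)

Section plateau.
Context {R : realType} (s t e : R).
Context (s0 : 0 < s) (e0 : 0 < e) (e4 : 4 * e <= t - s).

(** Rises from 0 to 1 over `[s, s + 2 * e] and falls back to 0 over
    `[t - 2 * e, t]. *)
Definition plateau (x : R) := smooth_step e (x - s) - smooth_step e (x - (t - 2 * e)).

Lemma is_derive_plateau (x : R) :
  is_derive x 1 plateau (tent e (x - s) - tent e (x - (t - 2 * e))).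
Proof.
have h1 := is_derive_smooth_step e0 s x.
have h2 := is_derive_smooth_step e0 (t - 2 * e) x.
rewrite (_ : plateau = (fun x => smooth_step e (x - s)) -
  (fun x => smooth_step e (x - (t - 2 * e)))); last by apply/funext.
exact: is_deriveB.
Qed.

Lemma derive1_plateau x :
  derive1 plateau x = tent e (x - s) - tent e (x - (t - 2 * e)).
Proof. by rewrite derive1E (@derive_val _ _ _ _ _ _ _ (is_derive_plateau x)). Qed.

Lemma plateau_derivable (x : R) : derivable plateau x 1.
Proof. exact: (@ex_derive _ _ _ _ _ _ _ (is_derive_plateau x)). Qed.

Lemma plateau_eq0 x : ~~ (s <= x <= t) -> plateau x = 0.
Proof.
have [ep e4'] := (e0, e4).
rewrite negb_and -!ltNge /plateau => /orP[xs|tx].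
  by rewrite !smooth_step_le0 ?subrr//; lra.
by rewrite !(smooth_step_ge e0) ?subrr//; lra.
Qed.

Lemma plateau_eq1 x : s + 2 * e <= x <= t - 2 * e -> plateau x = 1.
Proof.
by move=> /andP[sx xt]; rewrite /plateau (smooth_step_ge e0) ?(smooth_step_le0 e0); lra.
Qed.

Lemma plateau_ge0 x : 0 <= plateau x.
Proof.
by have e4' := e4; have ep := e0; rewrite subr_ge0; apply: smooth_step_nondecreasing => //; lra.
Qed.

Lemma plateau_le1 x : plateau x <= 1.
Proof.
have ep := e0; have h1 : smooth_step e (x - s) <= 1.
  rewrite -(smooth_step_ge e0 (lexx (2 * e))); have [xs|sx] := leP (x - s) (2 * e).
    exact: smooth_step_nondecreasing.
  by rewrite !(smooth_step_ge e0)//; lra.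
have h2 : 0 <= smooth_step e (x - (t - 2 * e)).
  rewrite -(smooth_step_le0 e0 (lexx 0)); have [xs|sx] := leP 0 (x - (t - 2 * e)).
    exact: smooth_step_nondecreasing.
  by rewrite !(smooth_step_le0 e0)//; lra.
by rewrite /plateau; lra.
Qed.

Lemma derive1_plateau_continuous : continuous (derive1 plateau).
Proof.
rewrite (_ : derive1 plateau = fun x => tent e (x - s) - tent e (x - (t - 2 * e))).
  by move=> x; apply: cvgB; exact: tent_continuous.
by apply/funext => x; exact: derive1_plateau.
Qed.

Lemma plateau_continuous : continuous plateau.
Proof.
move=> x; apply: differentiable_continuous.
by apply/derivable1_diffP; exact: plateau_derivable.
Qed.

Lemma plateau_test_function : test_function plateau.
Proof.
split; [exact: plateau_derivable|exact: derive1_plateau_continuous|].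
by exists s, t; split=> // x; exact: plateau_eq0.
Qed.

Local Notation mu := lebesgue_measure.

Lemma segment_integrable (a b : R) (f : R -> R) : {within `[a, b], continuous f} ->
  mu.-integrable `[a, b] (EFin \o f).
Proof.
by move=> fc; apply: continuous_compact_integrable => //; exact: segment_compact.
Qed.

(** The integral of a tent is the increment of the corresponding step. *)
Lemma Rintegral_tent a : s <= a -> a + 2 * e <= t ->
  \int[mu]_(x in `[s, t]) tent e (x - a) = 1.
Proof.
have [ep e4'] := (e0, e4) => sa at_; rewrite /Rintegral.
have der (z : R) := is_derive_smooth_step e0 a z.
have cF : continuous (fun y => smooth_step e (y - a)).
  move=> z; apply: differentiable_continuous; apply/derivable1_diffP.
  exact: (@ex_derive _ _ _ _ _ _ _ (der z)).
rewrite (@continuous_FTC2 _ _ (fun y => smooth_step e (y - a))).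
- by rewrite (smooth_step_ge e0) ?(smooth_step_le0 e0) ?sube0//; lra.
- by lra.
- by apply: continuous_subspaceT; exact: tent_continuous.
- split.
  + by move=> z _; exact: (@ex_derive _ _ _ _ _ _ _ (der z)).
  + by apply: cvg_at_right_filter; exact: cF.
  + by apply: cvg_at_left_filter; exact: cF.
- by move=> z _; rewrite derive1E (@derive_val _ _ _ _ _ _ _ (der z)).
Qed.

Lemma Rintegral_plateau_le : \int[mu]_(x in `[s, t]) plateau x <= t - s.
Proof.
have [ep e4'] := (e0, e4).
have -> : t - s = \int[mu]_(x in `[s, t]) (1 : R).
  rewrite Rintegral_cst//= mul1r lebesgue_measure_itv/= lte_fin.
  by case: ltP => // ts; lra.
apply: le_Rintegral => //.
- by apply: segment_integrable; apply: continuous_subspaceT; exact: plateau_continuous.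
- by apply: segment_integrable; apply: continuous_subspaceT; exact: cst_continuous.
- by move=> x _; exact: plateau_le1.
Qed.

Lemma Rintegral_plateau_ge : t - s - 4 * e <= \int[mu]_(x in `[s, t]) plateau x.
Proof.
have [ep e4'] := (e0, e4).
have bi : mu.-integrable `[s, t] (EFin \o plateau).
  by apply: segment_integrable; apply: continuous_subspaceT; exact: plateau_continuous.
rewrite -lee_fin /Rintegral fineK; last exact: integrable_fin_num.
have -> : (t - s - 4 * e)%:E = (\int[mu]_(x in `[(s + 2 * e)%R, (t - 2 * e)%R]) (plateau x)%:E)%E.
  rewrite (eq_integral (cst 1%E)).
    rewrite integral_cst//= mul1e lebesgue_measure_itv/= lte_fin.
    by case: ltP => ts; rewrite ?EFinB -?EFinB; congr (_%:E); lra.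
  by move=> x; rewrite inE /= in_itv /= => xJ; rewrite plateau_eq1.
apply: ge0_subset_integral => //.
- by have /integrableP[] := bi.
- by move=> x _; rewrite lee_fin plateau_ge0.
- by move=> x /=; rewrite !in_itv /= => /andP[? ?]; apply/andP; split; lra.
Qed.

End plateau.

Lemma ae_lebesgue_filter (R : realType) :
  Filter (almost_everywhere (lebesgue_measure : measure (measurableTypeR R) R)).
Proof. exact: ae_filter_ringOfSetsType. Qed.

Section weak_derivative_estimates.
Context {R : realType} {H : completeNormedModType R}.
Context (dot : {dot H for idfun}).
Context (dot_norm : forall u : H, dot u u = `|u| ^+ 2).
Implicit Types (u g : R -> H) (h : H).
Local Notation mu := lebesgue_measure.

(** A preimage under a simple function is a finite union of its level sets. *)
Lemma strongly_measurable_dot g h : strongly_measurable g ->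
  measurable_fun setT (fun r => dot (g r) h).
Proof.
move=> [f fs fg].
apply: (@measurable_fun_cvg _ _ R setT (fun n r => dot (f n r) h)).
  move=> n mT B mB; rewrite setTI; have [ffin fm] := fs n.
  have -> : (fun r => dot (f n r) h) @^-1` B =
      \bigcup_(y in range (f n) `&` [set y | B (dot y h)]) (f n @^-1` [set y]).
    apply/seteqP; split=> [r Br|r [y [_ /= By] /= ry]]; last by rewrite ry.
    by exists (f n r) => //; split=> //; exists r.
  by apply: fin_bigcup_measurable => [|y _]; [exact: finite_setIl|exact: fm].
move=> r _; have dc := @dot_continuous R H dot dot_norm h (g r).
exact: cvg_comp (fg r) dc.
Qed.

Lemma integral_support (A D : set R) (f : R -> \bar R) :
  A `<=` D -> (forall x, ~ A x -> f x = 0%E) ->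
  (\int[mu]_(x in D) f x = \int[mu]_(x in A) f x)%E.
Proof.
move=> AD f0; rewrite integral_mkcond [RHS]integral_mkcond.
apply: eq_integral => x _; rewrite !patchE.
case: ifPn => xD; case: ifPn => xA //; last first.
  by case/negP: xD; move: xA; rewrite !inE; exact: AD.
by apply: f0 => Ax; case/negP: xA; rewrite inE.
Qed.

(** Testing the weak derivative against the plateau of width e: the tents at both
    ends average u near s and near t. *)
Lemma weak_derivative_plateau u g h (M s t e k : R) :
  {within `[0, +oo[, continuous u} -> strongly_measurable g ->
  locally_ess_bounded g -> weak_derivative dot u g ->
  0 < s -> 0 < e -> 4 * e <= t - s ->
  {ae mu, forall r : R, s <= r <= t -> dot (g r) h <= M} ->
  (forall r : R, s <= r <= s + 2 * e -> dot (u r) h <= dot (u s) h + k) ->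
  (forall r : R, t - 2 * e <= r <= t -> dot (u t) h - k <= dot (u r) h) ->
  dot (u t) h - dot (u s) h <= 2 * k + M * (t - s) + 4 * e * `|M|.
Proof.
move=> uc gm gb wd s0 e0 e4 gM us ut.
have st : s < t by lra.
have [se et te] : [/\ s + 2 * e <= t, s <= t - 2 * e & t - 2 * e + 2 * e <= t].
  by split; lra.
have pointwise r : s <= r <= t ->
    dot (u r) h * (tent e (r - s) - tent e (r - (t - 2 * e))) <=
    (dot (u s) h + k) * tent e (r - s) - (dot (u t) h - k) * tent e (r - (t - 2 * e)).
  move=> /andP[sr rt]; rewrite mulrBr.
  have h1 : dot (u r) h * tent e (r - s) <= (dot (u s) h + k) * tent e (r - s).
    have [re|re] := leP r (s + 2 * e).
      by rewrite ler_wpM2r ?tent_ge0// us// sr.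
    by rewrite tent_eq0 ?mulr0//; apply/negP => /andP[]; lra.
  have h2 : (dot (u t) h - k) * tent e (r - (t - 2 * e)) <=
      dot (u r) h * tent e (r - (t - 2 * e)).
    have [re|re] := leP (t - 2 * e) r.
      by rewrite ler_wpM2r ?tent_ge0// ut// re.
    by rewrite tent_eq0 ?mulr0//; apply/negP => /andP[]; lra.
  by lra.
have conclude (X Y : R) : X <= M * Y ->
    - X <= (dot (u s) h + k) - (dot (u t) h - k) ->
    Y <= t - s -> t - s - 4 * e <= Y ->
    dot (u t) h - dot (u s) h <= 2 * k + M * (t - s) + 4 * e * `|M|.
  move=> X1 X2 Y1 Y2; have [M0|M0] := leP 0 M.
    by rewrite ger0_norm//; have := ler_wpM2l M0 Y1; have := mulr_ge0 (ltW e0) M0; lra.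
  by rewrite ltr0_norm//; have := ler_wnM2l (ltW M0) Y2; lra.
pose I : set (measurableTypeR R) := [set` `[s, t]].
have mI : measurable I by exact: measurable_itv.
have ID : I `<=` `]0, +oo[.
  by move=> x; rewrite /I /= !in_itv /= andbT => /andP[sx _]; exact: lt_le_trans sx.
pose eta := plateau s t e.
have [Mg gMg] := gb s t s0.
pose B := `|M| + `|Mg| * `|h|.
have B0 : 0 <= B by rewrite addr_ge0// mulr_ge0.
(* dot (g r) h is only bounded almost everywhere; gam is a truncation of it. *)
pose gam r := Num.max (- B) (Num.min (dot (g r) h) M).
have gamB r : `|gam r| <= B.
  have := ler_norm M; have hb : 0 <= `|Mg| * `|h| by exact: mulr_ge0.
  have := ler_norm (- M); rewrite normrN /gam ler_norml /B => h1 h2.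
  rewrite le_max lexx/= ge_max; apply/andP; split; first lra.
  by rewrite ge_min; apply/orP; right; lra.
have gamM r : gam r <= M.
  rewrite /gam ge_max ge_min lexx orbT andbT.
  by have := ler_norm (- M); have : 0 <= `|Mg| * `|h| by []; rewrite normrN /B; lra.
have mg : measurable_fun setT (fun r => dot (g r) h) by exact: strongly_measurable_dot.
have mgam : measurable_fun setT gam.
  apply: measurable_maxr => //.
  exact: measurable_minr.
have meta : measurable_fun setT eta.
  by apply: continuous_measurable_fun; exact: plateau_continuous.
have wc : {within I, continuous (fun r => dot (u r) h)}.
  have : {within I, continuous u}.
    apply: continuous_subspaceW uc => x; rewrite /I /= !in_itv /= andbT => /andP[sx _].
    exact: le_trans (ltW s0) sx.
  by move=> c x; exact: cvg_comp (c x) (@dot_continuous R H dot dot_norm h (u x)).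
have gi : mu.-integrable I (EFin \o (fun r => gam r * eta r)).
  apply: measurable_bounded_integrable; first exact: mI.
  - by rewrite /I /= lebesgue_measure_itv /=; case: ifP => _; rewrite -?EFinB ltry.
  - by apply: measurable_funTS; exact: measurable_funM.
  - exists B; split; first exact: num_real.
    move=> x Bx r _ /=; apply: le_trans (ltW Bx); rewrite normrM.
    rewrite -[leRHS]mulr1 ler_pM// ger0_norm ?plateau_ge0//.
    exact: plateau_le1.
have etai : mu.-integrable I (EFin \o eta).
  by apply: segment_integrable; apply: continuous_subspaceT; exact: plateau_continuous.
have tenti a : mu.-integrable I (EFin \o (fun x => tent e (x - a))).
  by apply: segment_integrable; apply: continuous_subspaceT; exact: tent_continuous.
have main : \int[mu]_(r in I) (dot (u r) h * derive1 eta r) =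
    - \int[mu]_(r in I) (gam r * eta r).
  have eta0 x : ~ I x -> eta x = 0.
    by rewrite /I /= in_itv /= => /negP xI; exact: plateau_eq0.
  have := wd eta h (plateau_test_function s0 e0 e4).
  rewrite (@integral_support I)//; last first.
    move=> x xI; rewrite derive1_plateau//.
    have xE : ~~ (s <= x <= t) by apply/negP => xI'; apply: xI; rewrite /I /= in_itv.
    rewrite !tent_eq0 ?subrr ?mulr0//; apply: contra xE => /andP[h1 h2]; apply/andP; split; lra.
  rewrite (@integral_support I _ (fun r => (dot (g r) h * eta r)%:E))//; last first.
    by move=> x /eta0 ->; rewrite mulr0.
  have meas (f : R -> R) : measurable_fun setT f ->
      measurable_fun I (fun r => (f r * eta r)%:E).
    by move=> mf; apply/measurable_EFinP; apply: measurable_funTS; exact: measurable_funM.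
  have -> : (\int[mu]_(r in I) (dot (g r) h * eta r)%:E =
      \int[mu]_(r in I) (gam r * eta r)%:E)%E.
    apply: ae_eq_integral => //; [exact: meas|exact: meas|].
    have FF := ae_lebesgue_filter R.
    apply: (@filterS2 _ _ FF _ _ _ _ gM gMg) => r rM rMg; rewrite /I /= in_itv /= => rI.
    congr ((_ * _)%:E); rewrite /gam (min_idPl (rM rI)) max_r//.
    have := norm_dot_le dot_norm (g r) h; rewrite ler_norml => /andP[+ _].
    have h1 : `|g r| * `|h| <= `|Mg| * `|h|.
      by rewrite ler_wpM2r//; exact: le_trans (rMg rI) (ler_norm _).
    by have := normr_ge0 M; rewrite /B; lra.
  by move=> e1; rewrite /Rintegral e1 fineN.
have r1 : \int[mu]_(r in I) (gam r * eta r) <= M * \int[mu]_(r in I) eta r.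
  rewrite -RintegralZl//; apply: le_Rintegral => //.
    exact: (integrableZl _ M etai).
  by move=> r _; rewrite ler_wpM2r// plateau_ge0.
have r2 : \int[mu]_(r in I) (dot (u r) h * derive1 eta r) <=
    (dot (u s) h + k) - (dot (u t) h - k).
  pose rho1 r := (dot (u s) h + k) * tent e (r - s).
  pose rho2 r := (dot (u t) h - k) * tent e (r - (t - 2 * e)).
  have i1 : mu.-integrable I (EFin \o rho1) by exact: (integrableZl _ (dot (u s) h + k) (tenti s)).
  have i2 : mu.-integrable I (EFin \o rho2).
    exact: (integrableZl _ (dot (u t) h - k) (tenti (t - 2 * e))).
  have -> : (dot (u s) h + k) - (dot (u t) h - k) = \int[mu]_(r in I) (rho1 r - rho2 r).
    have tent1 a : s <= a -> a + 2 * e <= t -> \int[mu]_(x in I) tent e (x - a) = 1.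
      exact: Rintegral_tent.
    rewrite RintegralB// /rho1 RintegralZl// tent1// mulr1.
    by rewrite /rho2 RintegralZl// tent1// mulr1.
  apply: le_Rintegral => //.
  - apply: segment_integrable => x; apply: cvgM; first exact: wc.
    by apply: continuous_subspaceT => y; exact: derive1_plateau_continuous.
  - exact: (integrableB mI i1 i2).
  move=> r; rewrite /I /= in_itv /= derive1_plateau//; exact: pointwise.
apply: (conclude _ _ r1).
- by rewrite -main.
- exact: Rintegral_plateau_le.
- exact: Rintegral_plateau_ge.
Qed.

(** The plateau estimate in the limit of vanishing width. *)
Lemma weak_derivative_le u g h (M s t : R) :
  {within `[0, +oo[, continuous u} -> strongly_measurable g ->
  locally_ess_bounded g -> weak_derivative dot u g -> 0 < s -> s < t ->
  {ae mu, forall r : R, s <= r <= t -> dot (g r) h <= M} ->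
  dot (u t - u s) h <= M * (t - s).
Proof.
move=> uc gm gb wd s0 st gM; rewrite dotBl.
have uc' r : 0 < r -> {for r, continuous (fun r => dot (u r) h)}.
  move=> r0; have ur : {for r, continuous u}.
    have /continuous_within_itvcyP[c _] := uc.
    by apply: c; rewrite in_itv /= r0.
  exact: cvg_comp ur (@dot_continuous R H dot dot_norm h (u r)).
apply/ler_addgt0Pr => k k0; pose k' := k / 4.
have k'0 : 0 < k' by rewrite divr_gt0.
have /cvgrPdist_le /(_ _ k'0) := uc' s s0.
move=> /nbhs_ballP[d1 /= d10 ud1].
have /cvgrPdist_le /(_ _ k'0) := uc' t (lt_trans s0 st).
move=> /nbhs_ballP[d2 /= d20 ud2].
have M1 : 0 < `|M| + 1 by rewrite ltr_wpDl.
pose e := Num.min (Num.min (d1 / 4) (d2 / 4)) (Num.min ((t - s) / 4) (k / (8 * (`|M| + 1)))).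
have e0 : 0 < e.
  by rewrite /e !lt_min !divr_gt0 ?subr_gt0 ?mulr_gt0.
have [e1 e2 e3 e4] : [/\ e <= d1 / 4, e <= d2 / 4, e <= (t - s) / 4 & e <= k / (8 * (`|M| + 1))].
  by split; rewrite /e !ge_min lexx ?orbT.
clearbody e; have e3' : 4 * e <= t - s by lra.
have main : dot (u t) h - dot (u s) h <= 2 * k' + M * (t - s) + 4 * e * `|M|.
  apply: (weak_derivative_plateau uc gm gb wd s0 e0 e3' gM).
    move=> r /andP[h1 h2]; have : ball s d1 r by rewrite /ball /= ltr_norml; apply/andP; split; lra.
    by move=> /ud1; rewrite ler_norml => /andP[]; lra.
  move=> r /andP[h1 h2]; have : ball t d2 r by rewrite /ball /= ltr_norml; apply/andP; split; lra.
  by move=> /ud2; rewrite ler_norml => /andP[]; lra.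
have : e * (8 * (`|M| + 1)) <= k by rewrite -ler_pdivlMr// mulr_gt0.
by move: main; rewrite /k'; have := mulr_ge0 (ltW e0) (normr_ge0 M); lra.
Qed.

End weak_derivative_estimates.

(** Over n equal subintervals the increments add up to at most
    K * (t - s) ^+ 2 / n. *)
Lemma le_of_quadratic_increments {R : realType} (f : R -> R) (K s t : R) : s < t ->
  (forall a b, s <= a -> a <= b -> b <= t -> f b - f a <= K * (b - a) ^+ 2) ->
  f t <= f s.
Proof.
move=> st fK; rewrite leNgt; apply/negP => fst.
have c0 : 0 < f t - f s by rewrite subr_gt0.
pose n := (Num.bound `|K * (t - s) ^+ 2 / (f t - f s)|).+1.
have n0 : 0 < n%:R :> R by rewrite ltr0n.
have nK : K * (t - s) ^+ 2 < n%:R * (f t - f s).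
  rewrite -ltr_pdivrMr//; apply: le_lt_trans (ler_norm _) _.
  apply: lt_trans (archi_boundP (normr_ge0 _)) _.
  by rewrite ltr_nat.
pose d := (t - s) / n%:R.
have d0 : 0 < d by rewrite divr_gt0// subr_gt0.
have dn : n%:R * d = t - s by rewrite mulrC divfK// gt_eqF.
have step i : (i <= n)%N -> f (s + i%:R * d) - f s <= i%:R * (K * d ^+ 2).
  elim: i => [_|i ih ilen]; first by rewrite !mul0r addr0 subrr.
  have {}ih := ih (ltnW ilen).
  have id : 0 <= i%:R * d by rewrite mulr_ge0// ltW.
  have i1 : i.+1%:R * d = i%:R * d + d by rewrite -natr1 mulrDl mul1r.
  have id1 : i%:R * d + d <= t - s.
    by rewrite -i1 -dn ler_pM2r// ler_nat.
  have := fK (s + i%:R * d) (s + i.+1%:R * d); rewrite i1.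
  have -> : s + (i%:R * d + d) - (s + i%:R * d) = d by ring.
  have -> : i.+1%:R * (K * d ^+ 2) = i%:R * (K * d ^+ 2) + K * d ^+ 2.
    by rewrite -natr1 mulrDl mul1r.
  by move=> h; have {}h := h ltac:(lra) ltac:(lra) ltac:(lra); lra.
have := step n (leqnn n); rewrite dn [s + _]addrC subrK => h.
have : n%:R * (f t - f s) <= K * (t - s) ^+ 2.
  rewrite -dn exprMn; have := ler_wpM2l (ltW n0) h.
  by rewrite expr2 !mulrA; lra.
by rewrite leNgt nK.
Qed.

Section decay.
Context {R : realType} {H : completeNormedModType R}.
Context (dot : {dot H for idfun}).
Context (dot_norm : forall u : H, dot u u = `|u| ^+ 2).
Local Notation mu := lebesgue_measure.
Context (u g : R -> H) (u_cont : {within `[0, +oo[, continuous u}).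
Context (g_meas : strongly_measurable g) (g_bounded : locally_ess_bounded g).
Context (ug : weak_derivative dot u g).

(** Test with h = u t - u s. *)
Lemma weak_derivative_lipschitz (L s t : R) : 0 < s -> s <= t -> 0 <= L ->
  {ae mu, forall r : R, s <= r <= t -> `|g r| <= L} ->
  `|u t - u s| <= L * (t - s).
Proof.
move=> s0; rewrite le_eqVlt => /predU1P[<-|st] L0 gL.
  by rewrite !subrr normr0 mulr0.
have FF := ae_lebesgue_filter R.
have := @weak_derivative_le R H dot dot_norm u g (u t - u s) (L * `|u t - u s|) s t
  u_cont g_meas g_bounded ug s0 st.
rewrite dot_norm => h.
have {}h : `|u t - u s| ^+ 2 <= L * `|u t - u s| * (t - s).
  apply: h; apply: filterS gL => r rL rI.
  apply: le_trans (dot_le_norm dot_norm _ _) _.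
  by rewrite ler_wpM2r// rL.
have [->|n0] := eqVneq `|u t - u s| 0; first by rewrite mulr_ge0// subr_ge0 ltW.
have n1 : 0 < `|u t - u s| by rewrite lt_neqAle eq_sym n0/=.
by move: h; rewrite expr2 mulrAC ler_pM2r.
Qed.

(** D is thought of as a function with gradient p. Along the flow D decreases
    at the rate prescribed for dot (g r) (p (u r)): the first order expansion
    of D over a short time interval has a quadratic error, and subdividing makes
    the total error vanish. *)
Lemma weak_derivative_decay (D : H -> R) (p : H -> H) (delta b : R) :
  (forall x y, D y <= D x + dot (p x) (y - x) + `|y - x| ^+ 2 / 2) ->
  (forall x y, `|p x - p y| <= 2 * `|x - y|) ->
  {ae mu, forall r : R, 0 < r < b -> dot (g r) (p (u r)) <= - delta} ->
  forall s t, 0 < s -> s < t -> t < b -> D (u t) <= D (u s) - delta * (t - s).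
Proof.
move=> Dp pL gp s t s0 st tb.
have FF := ae_lebesgue_filter R.
have [L0 gL0] := g_bounded t s0.
pose L := `|L0|; have Lge0 : 0 <= L by exact: normr_ge0.
have gL : {ae mu, forall r : R, s <= r <= t -> `|g r| <= L}.
  by apply: filterS gL0 => r rL /rL /le_trans; apply; exact: ler_norm.
clearbody L.
suff : D (u t) + delta * t <= D (u s) + delta * s by lra.
apply: (@le_of_quadratic_increments R (fun r => D (u r) + delta * r) (3 * L ^+ 2) s t st).
move=> a c sa; rewrite le_eqVlt => /predU1P[<- _|ac ct].
  by rewrite !subrr expr0n/= mulr0.
have a0 : 0 < a by exact: lt_le_trans sa.
have gLac : {ae mu, forall r : R, a <= r <= c -> `|g r| <= L}.
  apply: filterS gL => r rL /andP[ar rc]; apply: rL.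
  by rewrite (le_trans sa ar) (le_trans rc ct).
have lip r : a <= r -> r <= c -> `|u r - u a| <= L * (r - a).
  move=> ar rc; apply: weak_derivative_lipschitz => //.
  by apply: filterS gLac => r' rL /andP[ar' rr']; apply: rL; rewrite ar' (le_trans rr' rc).
have grad : dot (u c - u a) (p (u a)) <= (2 * L ^+ 2 * (c - a) - delta) * (c - a).
  apply: (@weak_derivative_le R H dot dot_norm u g) => //.
  apply: (@filterS2 _ _ FF _ _ _ _ gp gLac) => r rp rL /andP[ar rc].
  have h1 : dot (g r) (p (u r)) <= - delta.
    by apply: rp; rewrite (lt_le_trans a0 ar) (le_lt_trans (le_trans rc ct) tb).
  have h2 : dot (g r) (p (u a) - p (u r)) <= L * (2 * (L * (c - a))).
    apply: le_trans (dot_le_norm dot_norm _ _) _; apply: ler_pM => //.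
      by apply: rL; rewrite ar rc.
    apply: le_trans (pL _ _) _; rewrite ler_pM2l// distrC.
    by apply: le_trans (lip _ ar rc) _; rewrite ler_wpM2l// lerD2r.
  by move: h2; rewrite dotBr; lra.
have h1 := Dp (u a) (u c).
have h2 : `|u c - u a| ^+ 2 <= (L * (c - a)) ^+ 2.
  have ca : 0 <= c - a by rewrite subr_ge0 ltW.
  by rewrite lerXn2r ?nnegrE ?mulr_ge0// lip// ltW.
have h3 : 0 <= (L * (c - a)) ^+ 2 by exact: sqr_ge0.
move: h1 grad h2 h3; rewrite (dotC dot (u c - u a)) exprMn; lra.
Qed.

(** The same estimate from time 0 on, by continuity of u at 0. *)
Lemma weak_derivative_decay0 (D : H -> R) (p : H -> H) (delta b : R) :
  (forall x y, D y <= D x + dot (p x) (y - x) + `|y - x| ^+ 2 / 2) ->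
  (forall x y, `|p x - p y| <= 2 * `|x - y|) ->
  {ae mu, forall r : R, 0 < r < b -> dot (g r) (p (u r)) <= - delta} ->
  forall t, 0 < t -> t < b -> D (u t) <= D (u 0) - delta * t.
Proof.
move=> Dp pL gp t t0 tb.
have u0 : u x @[x --> 0^'+] --> u 0.
  by have /continuous_within_itvcyP[] := u_cont.
apply/ler_addgt0Pr => e e0.
pose eta := Num.min 1 (e / 2 / (`|p (u 0)| + 1)).
have p1 : 0 < `|p (u 0)| + 1 by rewrite ltr_wpDl.
have eta0 : 0 < eta by rewrite /eta lt_min ltr01 !divr_gt0.
have eta1 : eta <= 1 by rewrite /eta ge_min lexx.
have etae : eta * (`|p (u 0)| + 1) <= e / 2.
  by rewrite -ler_pdivlMr// /eta ge_min lexx orbT.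
clearbody eta.
have /cvgrPdist_le /(_ _ eta0) near0 := u0.
have d1 : 0 < `|delta| + 1 by rewrite ltr_wpDl.
have s1 : 0 < e / 2 / (`|delta| + 1) by rewrite !divr_gt0.
have [s [s0 st us se]] : exists s, [/\ 0 < s, s < t, `|u 0 - u s| <= eta &
    s < e / 2 / (`|delta| + 1)].
  have := @filter_ex _ (0%R : R)^'+ _ [set s | [/\ 0 < s, s < t, `|u 0 - u s| <= eta &
    s < e / 2 / (`|delta| + 1)]]; apply.
  near=> s; split; near: s => //.
  - exact: nbhs_right_gt.
  - exact: nbhs_right_lt.
  - exact: nbhs_right_lt.
have h1 := weak_derivative_decay Dp pL gp s0 st tb.
have h2 := Dp (u 0) (u s).
have h3 : dot (p (u 0)) (u s - u 0) <= `|p (u 0)| * eta.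
  apply: le_trans (dot_le_norm dot_norm _ _) _.
  by rewrite ler_wpM2l// distrC.
have h4 : `|u s - u 0| ^+ 2 <= eta ^+ 2.
  by rewrite distrC lerXn2r ?nnegrE// ltW.
have h5 : eta ^+ 2 <= eta by rewrite expr2 ler_piMr// ltW.
have h6 : delta * s <= e / 2.
  have ds : s * (`|delta| + 1) <= e / 2 by rewrite -ler_pdivlMr// ltW.
  have := ler_wpM2r (ltW s0) (ler_norm delta); lra.
lra.
Unshelve. all: by end_near. Qed.

End decay.

(** * Invariance of closed convex sets *)

Section closure_convex.
Context {R : realType} {H : completeNormedModType R}.

Lemma closure_normP (A : set H) x :
  closure A x <-> forall e, 0 < e -> exists2 a, A a & `|x - a| < e.
Proof.
split=> [clx e e0|clx U /nbhs_ballP[e /= e0 eU]].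
  have [a [Aa ax]] := clx _ (nbhsx_ballx x e e0).
  by exists a => //; rewrite -ball_normE in ax.
have [a Aa ax] := clx e e0; exists a; split=> //; apply: eU.
by rewrite -ball_normE.
Qed.

Lemma convex_set_closure (A : set H) : convex_set A -> convex_set (closure A).
Proof.
move=> /convex_setP cA; apply/convex_setP => x y t t01 /closure_normP clx /closure_normP cly.
apply/closure_normP => e e0; have [a Aa xa] := clx e e0; have [b Ab yb] := cly e e0.
exists (t *: a + (1 - t) *: b); first exact: cA.
have -> : t *: x + (1 - t) *: y - (t *: a + (1 - t) *: b) = t *: (x - a) + (1 - t) *: (y - b).
  by rewrite !scalerBr opprD addrACA.
have /andP[t0 t1] := t01.
apply: le_lt_trans (ler_normD _ _) _; rewrite !normrZ !ger0_norm//; last by rewrite subr_ge0.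
have [t_lt1|t_ge1] := ltP t 1.
  have := ler_wpM2l t0 (ltW xa); have := ltr_pM2l (_ : 0 < 1 - t) `|y - b| e.
  rewrite subr_gt0 => /(_ t_lt1); rewrite yb; lra.
have -> : t = 1 by apply/eqP; rewrite eq_le t1.
by rewrite subrr mul0r mul1r addr0.
Qed.

End closure_convex.

Section invariance.
Context {R : realType} {V : tvsType R} {H : completeNormedModType R}.
Context (dot : {dot H for idfun}).
Context (dot_norm : forall u : H, dot u u = `|u| ^+ 2).
Context (j : {linear V -> H}) (j_cont : weak_continuous j).
Context (phi : V -> \bar R) (phi_ninfty : ninfty_free phi).
Context (phi_convex : convex_functional phi) (phi_proper : proper_functional phi).
Context (phi_lsc : lower_semicontinuous phi) (phi_elliptic : j_elliptic phi j).
Context (phiH : H -> \bar R) (phiHP : is_phiH dot phi j phiH).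
Context (S : R -> H -> H) (SP : generated_semigroup dot phi j S).
Context (C : set H) (C0 : C !=set0) (C_closed : closed C) (C_convex : convex_set C).
Implicit Types (u v w : H).

Local Notation mu := lebesgue_measure.
Local Notation P := (orth_proj C).
Local Notation J := (resolvent dot phi j).
Let K : set H := closure (j @` effdom phi).

Let K_closed : closed K. Proof. exact: closed_closure. Qed.

Let K_neq0 : K !=set0.
Proof.
have [x xphi] := phi_proper; exists (j x); apply: subset_closure; by exists x.
Qed.

Let K_convex : convex_set K.
Proof.
apply: convex_set_closure; apply/convex_setP => _ _ t t01 [x xd <-] [y yd <-].
exists (t *: x + (1 - t) *: y); last by rewrite linearD/= !linearZ.
have [r xr] := effdom_fin phi_ninfty xd; have [s ys] := effdom_fin phi_ninfty yd.
apply: le_lt_trans (convex_functional_fin phi_convex t01 xr ys) _.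
exact: ltry.
Qed.

Lemma resolvent_variational lambda u : 0 < lambda ->
  exists x r, [/\ phi x = r%:E, j x = J lambda u &
    forall y s, phi y = s%:E ->
      r + lambda^-1 * dot (u - J lambda u) (j y - J lambda u) <= s].
Proof.
move=> l0; have [omega omega0 [_ phic]] := phi_elliptic.
exact: (resolvent_ineq dot_norm j_cont phi_ninfty phi_convex phi_lsc omega0 phic phi_proper).
Qed.

Lemma resolvent_jsubgradient lambda u : 0 < lambda ->
  jsubgradient dot phi j (J lambda u, lambda^-1 *: (u - J lambda u)).
Proof.
move=> l0; have [x [r [xr jx xJ]]] := resolvent_variational u l0.
apply/(jsubgradientP _ _ phi_ninfty phi_convex); exists x, r; split=> // w s ws.
by rewrite dotZl; exact: xJ.
Qed.

Lemma jsubgradient_phiH v f : jsubgradient dot phi j (v, f) ->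
  exists2 r, phiH v = r%:E & forall w s, phiH w = s%:E -> r + dot f (w - v) <= s.
Proof.
have [nH cH _ _ sub] := phiHP; move=> /sub.
by move=> /(jsubgradientP _ _ nH cH)[x [r [xr /= <- xf]]]; exists r.
Qed.

Lemma resolvent_phiH lambda u : 0 < lambda ->
  exists2 r, phiH (J lambda u) = r%:E & forall w s, phiH w = s%:E ->
    r + lambda^-1 * dot (u - J lambda u) (w - J lambda u) <= s.
Proof.
move=> l0; have [r rE rP] := jsubgradient_phiH (resolvent_jsubgradient u l0).
by exists r => // w s ws; rewrite -dotZl; exact: rP.
Qed.

(** For u in the domain of phiH the resolvents J lambda u, which lie in the
    range of j on the domain of phi, converge to u as lambda tends to 0. *)
Lemma effdom_phiH_subset : effdom phiH `<=` K.
Proof.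
have [nH cH _ _ _] := phiHP.
move=> u /(effdom_fin nH)[s us]; apply/closure_normP => e e0.
have [r0 vr0 vP] := resolvent_phiH 0 ltr01.
set v := J 1 0 in vr0 vP; set f := 1^-1 *: (0 - v).
pose a := s - r0 - dot f (u - v).
(* If n = |u - J lambda u| were at least e, then the subgradient inequalities
   at J lambda u and at v would give n / lambda <= a / e + |f| <= c - 1, whereas
   n / lambda >= e / lambda = c. *)
pose c := `|a| / e + `|f| + 1.
have c0 : 0 < c by rewrite /c ltr_wpDl// addr_ge0// divr_ge0// ltW.
pose lambda := e / c; have l0 : 0 < lambda by exact: divr_gt0.
have [x [q [xr jx _]]] := resolvent_variational u l0.
have [r rE rP] := resolvent_phiH u l0.
exists (J lambda u); first by exists x => //; rewrite /effdom /= xr ltry.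
rewrite ltNge; apply/negP => ex.
set n := `|u - J lambda u| in ex.
have h1 := rP _ _ us; rewrite dot_norm -/n in h1.
have h2 := vP _ _ rE; rewrite -dotZl -/f in h2.
have h3 : dot f (u - J lambda u) <= `|f| * n by exact: dot_le_norm.
have h4 : dot f (J lambda u - v) = dot f (u - v) - dot f (u - J lambda u).
  by rewrite !dotBr; ring.
have h5 : lambda^-1 * n ^+ 2 <= a + `|f| * n by rewrite /a; lra.
have h6 : a <= `|a| / e * n.
  apply: le_trans (ler_norm a) _; rewrite mulrAC ler_pdivlMr//.
  by rewrite ler_wpM2l.
have n0 : 0 < n by exact: lt_le_trans ex.
have h7 : lambda^-1 * n ^+ 2 <= (c - 1) * n by rewrite /c; lra.
have h8 : lambda^-1 * n <= c - 1 by move: h7; rewrite expr2 mulrA ler_pM2r.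
have h9 : lambda^-1 * e <= lambda^-1 * n by rewrite ler_wpM2l// invr_ge0 ltW.
have h10 : lambda^-1 * e = c by rewrite /lambda invf_div divfK ?gt_eqF.
by move: h8 h9; rewrite h10; lra.
Qed.

(** At time 0 the semigroup is the projection onto K. *)
Lemma semigroup_invariant_proj : semigroup_leaves_invariant S C ->
  orth_proj K @` C `<=` C.
Proof.
move=> inv _ [c Cc <-]; have [flow ext] := SP.
have := inv 0 (lexx 0) (S 0 c) (imageP _ Cc); rewrite ext// -/K.
by have [_ ->] := flow _ (orth_proj_mem dot_norm K_neq0 K_closed K_convex c).
Qed.

(** Let v be the projection of u. If phiH v exceeded phiH u, then by lower
    semicontinuity the trajectory starting at v would approach u at a positive
    rate for small times; but it stays in C, where v is the point nearest to u. *)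
Lemma semigroup_invariant_phiH_proj_le : semigroup_leaves_invariant S C ->
  forall u, (phiH (P u) <= phiH u)%E.
Proof.
move=> inv u; have [nH cH _ lH _] := phiHP.
case: (functional_fin_or_pinfty nH u) => [[s us]|->]; last exact: leey.
have Ku : K u by apply: effdom_phiH_subset; rewrite /effdom /= us ltry.
set v := P u.
have Cv : C v by exact: orth_proj_mem.
have Kv : K v.
  apply: (@orth_proj_exchange _ _ dot dot_norm K C) => //.
    exact: semigroup_invariant_proj.
  by exists u.
rewrite leNgt us; apply/negP => sv.
have [a sa av] : exists2 a, s < a & (a%:E < phiH v)%E.
  case: (functional_fin_or_pinfty nH v) sv => [[q ->]|->].
    by rewrite lte_fin => sq; exists ((s + q) / 2); rewrite ?lte_fin; lra.
  by move=> _; exists (s + 1); rewrite ?ltry//; lra.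
have [flow _] := SP.
have [uc u0 [g [gm gb ug gphi]]] := flow _ Kv.
have [b b0 ba] : exists2 b, 0 < b & forall r, 0 < r -> r < b -> (a%:E < phiH (S r v))%E.
  have [U Uv Ua] := lH _ _ av.
  have : S x v @[x --> 0^'+] --> v.
    by have /continuous_within_itvcyP[_] := uc; rewrite u0.
  move=> /(_ _ Uv)/nbhs_ballP[b /= b0 bU]; exists b => // r r0 rb.
  apply: Ua; apply: bU => //; by rewrite /ball /= sub0r normrN gtr0_norm.
have b2 : 0 < b / 2 by rewrite divr_gt0.
have := @weak_derivative_decay0 R H dot dot_norm _ g uc gm gb ug
  (fun x => `|x - u| ^+ 2 / 2) (fun x => x - u) (a - s) b _ _ _ (b / 2) b2.
rewrite u0 => decay.
have {decay} : `|S (b / 2) v - u| ^+ 2 / 2 <= `|v - u| ^+ 2 / 2 - (a - s) * (b / 2).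
  apply: decay; last by lra.
  - move=> x y; have -> : y - u = (x - u) + (y - x) by rewrite [RHS]addrC addrA subrK.
    by rewrite (normD2 dot_norm); lra.
  - move=> x y; rewrite opprB addrA subrK; have := normr_ge0 (x - y); lra.
  - have FF := ae_lebesgue_filter R.
    apply: filterS gphi => r rphi /andP[r0 rb].
    have [q rq qP] := jsubgradient_phiH (rphi r0).
    have := qP _ _ us; have := ba r r0 rb; rewrite rq lte_fin.
    by rewrite dotNl -dotNr opprB; lra.
have Cb : C (S (b / 2) v).
  by apply: (inv _ (ltW b2)); exists v.
have := orth_proj_le dot_norm C0 C_closed C_convex u Cb; rewrite -/v => near.
have : `|u - v| ^+ 2 <= `|u - S (b / 2) v| ^+ 2 by rewrite lerXn2r ?nnegrE.
rewrite ![`|u - _|]distrC; have : 0 < (a - s) * (b / 2) by rewrite mulr_gt0// subr_gt0.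
lra.
Qed.

(** For u in C, the variational inequalities satisfied by v = J lambda u and by
    w = P v add up to `|w - v| ^+ 2 <= 0. *)
Lemma phiH_proj_le_resolvent_invariant :
  (forall u, (phiH (P u) <= phiH u)%E) ->
  forall lambda, 0 < lambda -> leaves_invariant (J lambda) C.
Proof.
move=> PH lambda l0 _ [u Cu <-]; have [nH _ _ _ _] := phiHP.
have [r vr vP] := resolvent_phiH u l0; set v := J lambda u in vr vP *.
have := PH v; rewrite vr.
case: (functional_fin_or_pinfty nH (P v)) => [[s ws]|->//].
rewrite ws lee_fin => sr.
have h1 : lambda^-1 * dot (u - v) (P v - v) <= 0 by have := vP _ _ ws; lra.
have h2 : dot (u - v) (P v - v) <= 0 by rewrite pmulr_rle0 ?invr_gt0 in h1.
have h3 := orth_proj_dot_le0 dot_norm C0 C_closed C_convex v Cu.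
have h4 : `|P v - v| ^+ 2 <= 0.
  rewrite -dot_norm; move: h2 h3; rewrite !dotE !(dotC dot _ u) !(dotC dot _ v); lra.
have : `|P v - v| ^+ 2 = 0 by apply/eqP; rewrite eq_le h4 sqr_ge0.
move=> /eqP; rewrite sqrf_eq0 normr_eq0 subr_eq0 => /eqP <-.
exact: orth_proj_mem.
Qed.

(** Let v be the projection of j uh. Preimages x of the points J lambda v of C
    satisfy phi x + lambda^-1 * `|j x - v| ^+ 2 <= phi uh; these sublevels
    decrease as lambda tends to 0, and any common point x of them has j x = v. *)
Lemma resolvent_invariant_lift :
  (forall lambda, 0 < lambda -> leaves_invariant (J lambda) C) ->
  forall uh, effdom phi uh -> exists vh,
    [/\ effdom phi vh, P (j uh) = j vh & (phi vh <= phi uh)%E].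
Proof.
move=> inv uh /(effdom_fin phi_ninfty)[c uc].
have [omega omega0 [_ phic]] := phi_elliptic.
set v := P (j uh); have Cv : C v by exact: orth_proj_mem.
pose F k := sublevel (penalized j phi k v) c.
have Fle k k' : k <= k' -> F k' `<=` F k.
  move=> kk' x; rewrite /F /sublevel /= /penalized; apply: le_trans.
  by rewrite leeD2l// lee_fin ler_wpM2r// sqr_ge0.
have [c' c'P] := penalized_sublevel dot_norm j_cont phi_ninfty phi_convex phi_lsc
  omega0 phic phi_proper v c ltr01.
have [x xF] : exists x, forall k, [set k | 1 <= k] k -> F k x.
  apply: (precompact_directed_intersection (phic c')).
  - by exists 1 => /=.
  - move=> k /= k1; have l0 : 0 < k^-1 by rewrite invr_gt0; lra.
    have [x [r [xr jx xP]]] := resolvent_variational v l0.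
    exists x; rewrite /F /sublevel /= /penalized xr -EFinD lee_fin jx distrC.
    have := xP _ _ uc; rewrite invrK => h1.
    have CJ : C (J k^-1 v) by apply: (inv _ l0); exists v.
    have h2 := orth_proj_dot_le0 dot_norm C0 C_closed C_convex (j uh) CJ.
    have h3 : `|v - J k^-1 v| ^+ 2 <= dot (v - J k^-1 v) (j uh - J k^-1 v).
      suff : dot (v - J k^-1 v) (j uh - J k^-1 v) =
          `|v - J k^-1 v| ^+ 2 - dot (j uh - v) (J k^-1 v - v) by move: h2; rewrite -/v; lra.
      rewrite -dot_norm !dotE (dotC dot (j uh) v) (dotC dot (j uh) (J k^-1 v)).
      by rewrite (dotC dot (J k^-1 v) v); ring.
    apply: le_trans h1; rewrite lerD2l; apply: ler_wpM2l h3; lra.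
  - by move=> k /= k1; apply: (penalized_weakly_closed dot_norm) => //; lra.
  - by move=> k /= k1; apply: subset_trans c'P; exact: Fle.
  - move=> k k' /= k1 k'1; exists (Num.max k k'); first by rewrite /= le_max k1.
    by move=> x xF; split; apply: Fle xF; rewrite le_max lexx ?orbT.
have [r xr] : exists r, phi x = r%:E.
  have := xF 1 (lexx 1); rewrite /F /sublevel /= /penalized.
  by case: (functional_fin_or_pinfty phi_ninfty x) => // ->.
have xk k : 1 <= k -> r + k * `|j x - v| ^+ 2 <= c.
  by move=> k1; have := xF k k1; rewrite /F /sublevel /= /penalized xr -EFinD lee_fin.
set n := `|j x - v| ^+ 2 in xk; have n0 : 0 <= n by exact: sqr_ge0.
have rc : r <= c by have := xk 1 (lexx 1); lra.
exists x; split; [by rewrite /effdom /= xr ltry| |by rewrite xr uc lee_fin].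
have [n00|nn0] := eqVneq n 0.
  by apply/esym/eqP; rewrite -subr_eq0 -normr_eq0 -sqrf_eq0; apply/eqP.
have n1 : 0 < n by rewrite lt_neqAle eq_sym nn0.
pose k := 1 + (c - r) / n.
have kn : k * n = n + (c - r) by rewrite /k mulrDl mul1r divfK.
have k1 : 1 <= k by rewrite lerDl divr_ge0// subr_ge0.
by have := xk k k1; rewrite kn addrCA [r + _]addrC subrK gerDr leNgt n1.
Qed.

(** Half the squared distance to C is nonincreasing along trajectories, because
    replacing a preimage of u by one of P u does not increase phi. *)
Lemma lift_semigroup_invariant :
  (forall uh, effdom phi uh -> exists vh,
    [/\ effdom phi vh, P (j uh) = j vh & (phi vh <= phi uh)%E]) ->
  semigroup_leaves_invariant S C.
Proof.
move=> lift t t0 _ [w Cw <-]; have [flow ext] := SP; rewrite ext// -/K.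
have PK : P @` K `<=` K.
  move=> _ [x /closure_normP clx <-]; apply/closure_normP => e e0.
  have [_ [xh xd <-] xe] := clx e e0; have [yh [yd Pe _]] := lift _ xd.
  exists (j yh); first by exists yh.
  by rewrite -Pe; apply: le_lt_trans xe; exact: orth_proj_nonexpansive.
have Cy : C (orth_proj K w).
  by apply: (@orth_proj_exchange _ _ dot dot_norm C K) => //; exists w.
have Ky : K (orth_proj K w) by exact: (orth_proj_mem dot_norm).
set y := orth_proj K w in Cy Ky *.
have [uc u0 [g [gm gb ug gphi]]] := flow _ Ky.
move: t0; rewrite le_eqVlt => /predU1P[<-|t0]; first by rewrite u0.
have := @weak_derivative_decay0 R H dot dot_norm _ g uc gm gb ug
  (fun x => `|x - P x| ^+ 2 / 2) (fun x => x - P x) 0 (t + 1) _ _ _ t t0.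
rewrite u0 => decay.
have {decay} : `|S t y - P (S t y)| ^+ 2 / 2 <= `|y - P y| ^+ 2 / 2 - 0 * t.
  apply: decay; last by lra.
  - move=> x z; have Px := orth_proj_mem dot_norm C0 C_closed C_convex x.
    have zx : `|z - P z| ^+ 2 <= `|z - P x| ^+ 2.
      by rewrite lerXn2r ?nnegrE//; exact: orth_proj_le.
    have zE : z - P x = (x - P x) + (z - x) by rewrite [RHS]addrC addrA subrK.
    by move: zx; rewrite zE (normD2 dot_norm (x - P x)); lra.
  - move=> x z; have -> : x - P x - (z - P z) = (x - z) - (P x - P z).
      by rewrite !opprB addrACA [RHS]addrACA; congr (_ + _); exact: addrC.
    apply: le_trans (ler_normB _ _) _.
    have := orth_proj_nonexpansive dot_norm C0 C_closed C_convex x z; lra.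
  - have FF := ae_lebesgue_filter R.
    apply: filterS gphi => r rphi /andP[r0 _].
    have /(jsubgradientP _ _ phi_ninfty phi_convex)[xh [q [xq jx xP]]] := rphi r0.
    have [|zh [zd Pe zle]] := lift xh; first by rewrite /effdom /= xq ltry.
    have [q' zq] := effdom_fin phi_ninfty zd.
    move: zle; rewrite zq xq lee_fin => q'q; have := xP _ _ zq.
    by rewrite -Pe jx dotNl -dotNr opprB; lra.
rewrite (orth_proj_id dot_norm C0 C_closed C_convex Cy) subrr normr0 expr0n/=.
rewrite mul0r mul0r subr0 => h.
have : `|S t y - P (S t y)| ^+ 2 = 0.
  by apply/eqP; rewrite eq_le sqr_ge0 andbT; lra.
move=> /eqP; rewrite sqrf_eq0 normr_eq0 subr_eq0 => /eqP ->.
exact: (orth_proj_mem dot_norm).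
Qed.

End invariance.

Theorem theorem3p2 (R : realType) (V : tvsType R)
    (H : completeNormedModType R) (dot : {dot H for idfun})
    (dot_norm : forall u : H, dot u u = `|u| ^+ 2)
    (j : {linear V -> H}) (j_cont : weak_continuous j)
    (phi : V -> \bar R) (phi_ninfty : ninfty_free phi)
    (phi_convex : convex_functional phi) (phi_proper : proper_functional phi)
    (phi_lsc : lower_semicontinuous phi) (phi_elliptic : j_elliptic phi j)
    (phiH : H -> \bar R) (phiHP : is_phiH dot phi j phiH)
    (S : R -> H -> H) (SP : generated_semigroup dot phi j S)
    (C : set H) (C_neq0 : C !=set0) (C_closed : closed C)
    (C_convex : convex_set C) :
  [<-> semigroup_leaves_invariant S C;
       forall lambda : R, 0 < lambda ->
         leaves_invariant (resolvent dot phi j lambda) C;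
       forall u : H, (phiH (orth_proj C u) <= phiH u)%E;
       forall uh : V, effdom phi uh -> exists vh : V,
         [/\ effdom phi vh, orth_proj C (j uh) = j vh & (phi vh <= phi uh)%E]].
Proof.
have s13 : semigroup_leaves_invariant S C ->
    forall u, (phiH (orth_proj C u) <= phiH u)%E.
  exact: (semigroup_invariant_phiH_proj_le dot_norm j_cont phi_ninfty phi_convex
    phi_proper phi_lsc phi_elliptic phiHP).
have s32 : (forall u, (phiH (orth_proj C u) <= phiH u)%E) ->
    forall lambda, 0 < lambda -> leaves_invariant (resolvent dot phi j lambda) C.
  exact: (phiH_proj_le_resolvent_invariant dot_norm j_cont phi_ninfty phi_convex
    phi_proper phi_lsc phi_elliptic phiHP).
have s24 := resolvent_invariant_lift dot_norm j_cont phi_ninfty phi_convex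
  phi_proper phi_lsc phi_elliptic C_neq0 C_closed C_convex.
have s41 := lift_semigroup_invariant dot_norm phi_ninfty phi_convex phi_proper SP
  C_neq0 C_closed C_convex.
tfae => [h|h|h|h].
- exact: s32 (s13 h).
- exact: s13 (s41 (s24 h)).
- exact: s24 (s32 h).
- exact: s41.
Qed.
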